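(* Let $b\in[H^\infty_d\otimes\mathscr L(\mathcal H)]_1$ be purely contractive. There is a bijection between completely positive extensions $\phi:\mathcal A+\mathcal A^*\to\mathscr L(\mathcal H)$ of $\mu_b:\mathcal S+\mathcal S^*\to\mathscr L(\mathcal H)$ and $\simeq_b$-equivalence classes of $\mathrm{Ext}(V^b)$.
   Context: Let $d\ge1$ and let $\mathcal H$ be a complex Hilbert space, finite dimensional or separable; $\mathscr L(\cdot)$ denotes bounded linear operators; $\bigvee$ denotes closed linear span; $\mathbb B^d$ is the open unit ball of $\mathbb C^d$, $zw^*:=\sum_jz_j\overline{w_j}$. For a row operator $T=(T_1,\dots,T_d):\mathcal J\otimes\mathbb C^d\to\mathcal J$ write $zT^*=\sum_jz_jT_j^*$, $Tz^*=\sum_j\overline{z_j}T_j$, and $T^\alpha=T_{i_1}\cdots T_{i_k}$ for a word $\alpha=i_1\cdots i_k$ in the free unital semigroup $\mathbb F^d$ on $d$ letters ($T^\emptyset=I$). $T$ is a $d$-isometry if it is an isometry from $\mathcal J\otimes\mathbb C^d$ to $\mathcal J$. For a vector-valued reproducing kernel Hilbert space with kernel $K(z,w)\in\mathscr L(\mathcal H)$, $K_w$ denotes the adjoint of evaluation at $w$, a map from $\mathcal H$ into the space, so $K(z,w)=K_z^*K_w$. $[H^\infty_d\otimes\mathscr L(\mathcal H)]_1$ is the closed unit ball of the multiplier algebra of the space $H^2_d\otimes\mathcal H$ of $\mathcal H$-valued functions with kernel $\frac{1}{1-zw^*}I_{\mathcal H}$ on $\mathbb B^d$; $b$ is purely contractive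 if $\|b(z)\|<1$ for all $z\in\mathbb B^d$. Put $H_b(z)=(I-b(z))^{-1}(I+b(z))$ and let the Herglotz space $\mathscr L(b)$ be the reproducing kernel Hilbert space with kernel $K(z,w)=K^b(z,w)=\frac12\frac{H_b(z)+H_b(w)^*}{1-zw^*}$. $V=V^b:\mathscr L(b)\otimes\mathbb C^d\to\mathscr L(b)$ is the partial isometry with initial space $\bigvee_{w\in\mathbb B^d,h\in\mathcal H}w^*K_wh$, where $w^*K_wh=(\overline{w_1}K_wh,\dots,\overline{w_d}K_wh)^T$, given there by $V(w^*K_wh)=(K_w-K_0)h$. $L=(L_1,\dots,L_d)$ are the left creation operators on the full Fock space over $\mathbb C^d$; $\mathcal A$ is the unital norm-closed algebra they generate; $\mathcal S\subset\mathcal A$ is the norm-closed span of $\{(I-Lz^* )^{-1}:z\in\mathbb B^d\}$. $\mathcal S+\mathcal S^*$ and $\mathcal A+\mathcal A^*$ denote norm closures of these sums. $\mu_b$ is the completely positive map on $\mathcal S+\mathcal S^*$ with $\mu_b((I-zL^* )^{-1}(I-Lw^* )^{-1})=K^b(z,w)$. A $d$-isometry $D$ on a Hilbert space $\mathcal J\supseteq\mathscr L(b)$ extends $V$, written $D\supseteq V$, if $D$ agrees with $V$ on the initial space of $V$. $\mathrm{Ext}(V)$ is the set of all $d$-isometries $D\supseteq V$ acting on Hilbert spaces $\mathcal J\supseteq\mathscr L(b)$ such that $K_0\mathcal H$ is cyclic for $D$, i.e. $\mathcal J=\bigvee_{\alpha\in\mathbb F^d}D^\alpha K_0\mathcal H$.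 For $D_1,D_2\in\mathrm{Ext}(V)$, $D_1\simeq_bD_2$ means that $D_1,D_2$ are unitarily equivalent via an onto isometry that restricts to the identity on $\mathscr L(b)$. *)

(* Defs.v *)
From HB Require Import structures.
From mathcomp Require Import all_boot all_order all_algebra.
From mathcomp Require Import complex ring.
From mathcomp Require Import boolp classical_sets functions cardinality reals.
From mathcomp Require Import topology normedtype.
Set Implicit Arguments.
Unset Strict Implicit.
Unset Printing Implicit Defensive.
Import Order.TTheory GRing.Theory Num.Theory.
Import numFieldNormedType.Exports.
Local Open Scope classical_set_scope.
Local Open Scope ring_scope.

Section DotInequalities.
Variables (C : numClosedFieldType) (U : lmodType C).
Variable dot : {dot U for @Num.conj C}.

Lemma dot_CauchySchwarz u v : `|dot u v| ^+ 2 <= dot u u * dot v v.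
Proof.
have [->|v0] := eqVneq v 0.
  by rewrite !linear0r normr0 expr0n /= mulr0.
have vv : 0 < dot v v by rewrite dnorm_gt0.
have := dnorm_ge0 dot (u - (dot u v / dot v v) *: v).
rewrite dnormB dnormZ linearZr_LR /= !rmorphM /= !conjCK fmorphV /=.
have -> : (dot v v)^* = dot v v by apply/CrealP; rewrite ger0_real// ltW.
rewrite normrM normfV (gtr0_norm vv) exprMn exprVn.
set D := dot v v in vv *; set p := dot u v.
rewrite normCK; have Dn0 : D != 0 by rewrite gt_eqF.
have -> : dot u u + p * p^* / D ^+ 2 * D - (p^* / D * p + p / D * p^*) =
  (dot u u * D - p * p^*) / D by field.
by rewrite pmulr_lge0 ?invr_gt0// subr_ge0.
Qed.

Lemma dot_triangle u v :
  sqrtC (dot (u + v) (u + v)) <= sqrtC (dot u u) + sqrtC (dot v v).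
Proof.
have d0 w : 0 <= sqrtC (dot w w) by rewrite sqrtC_ge0 dnorm_ge0.
rewrite -(@ler_pXn2r _ 2%N)// ?nnegrE ?addr_ge0//.
rewrite sqrrD !sqrtCK dnormD /= [leRHS]addrAC lerD2l.
have -> : dot u v + (dot u v)^* = 'Re (dot u v) *+ 2.
  by rewrite ReE -mulr_natr divfK// pnatr_eq0.
rewrite lerMn2r /=.
apply: (@le_trans _ _ `|dot u v|); first exact: (leif_Re_Creal (dot u v)).
rewrite -(@ler_pXn2r _ 2%N)// ?nnegrE ?mulr_ge0// exprMn !sqrtCK.
exact: dot_CauchySchwarz.
Qed.

End DotInequalities.

(* Inner products are linear in the first argument and conjugate-linear in the
   second one. *)
HB.mixin Record CompleteNormedModule_isHilbert (R : realType) T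
    & CompleteNormedModule R[i] T := {
  inner : {dot T for @Num.conj R[i]};
  inner_norm : forall x : T, inner x x = `|x| ^+ 2
}.

#[short(type="hilbertType")]
HB.structure Definition Hilbert (R : realType) :=
  {T of CompleteNormedModule R[i] T & CompleteNormedModule_isHilbert R T}.

Section HilbertSum.
Variables (R : realType) (d : nat) (E : hilbertType R).

(* The Hilbert space E (x) C^d, as the direct sum of d copies of E. *)
Definition hsum := {ffun 'I_d -> E}.
HB.instance Definition _ := GRing.Lmodule.on hsum.
HB.instance Definition _ := Choice.on hsum.

Definition hsum_dot (x y : hsum) : R[i] := \sum_j inner (x j) (y j).

Lemma hsum_dot_is_bilinear :
  bilinear_for *%R (@Num.conj R[i] \; *%R) hsum_dot.
Proof.
split=> [y|x] a u v; rewrite /hsum_dot /= mulr_sumr -big_split /=.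
  by apply: eq_bigr => j _; rewrite !ffunE linearPl.
by apply: eq_bigr => j _; rewrite !ffunE linearPr.
Qed.
HB.instance Definition _ :=
  bilinear_isBilinear.Build _ _ _ _ _ _ hsum_dot hsum_dot_is_bilinear.

Lemma hsum_dot_hermitian (x y : hsum) :
  hsum_dot x y = (-1) ^+ false * Num.conj (hsum_dot y x).
Proof.
rewrite mul1r rmorph_sum; apply: eq_bigr => j _.
by rewrite hermC mul1r.
Qed.
HB.instance Definition _ :=
  isHermitianSesquilinear.Build _ _ false (@Num.conj R[i]) hsum_dot
    hsum_dot_hermitian.

Lemma hsum_dot_gt0 (x : hsum) : x != 0 -> 0 < hsum_dot x x.
Proof.
move=> x0; rewrite lt_def sumr_ge0 ?andbT => [|j _]; last exact: dnorm_ge0.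
apply: contra x0; rewrite psumr_eq0 => [/allP x0|j _]; last exact: dnorm_ge0.
apply/eqP/ffunP => j; rewrite ffunE; apply/eqP.
have := x0 j (mem_index_enum j).
by rewrite /= (dnorm_eq0 (inner : {dot E for @Num.conj R[i]})).
Qed.
HB.instance Definition _ := isDotProduct.Build _ _ hsum_dot hsum_dot_gt0.

Definition hsum_norm (x : hsum) : R[i] := sqrtC (hsum_dot x x).

Lemma hsum_normD x y : hsum_norm (x + y) <= hsum_norm x + hsum_norm y.
Proof. exact: dot_triangle. Qed.

Lemma hsum_normZ (a : R[i]) x : hsum_norm (a *: x) = `|a| * hsum_norm x.
Proof. by rewrite /hsum_norm dnormZ sqrtCM ?nnegrE ?sqrCK ?exprn_ge0. Qed.

Lemma hsum_norm_eq0 x : hsum_norm x = 0 -> x = 0.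
Proof. by move/eqP; rewrite sqrt_dnorm_eq0 => /eqP. Qed.

HB.instance Definition _ := Lmodule_isNormed.Build R[i] hsum
  hsum_normD hsum_normZ hsum_norm_eq0.

Lemma hsum_normE (x : hsum) : `|x| ^+ 2 = \sum_j `|x j| ^+ 2.
Proof.
rewrite [LHS]sqrtCK; apply: eq_bigr => j _; exact: inner_norm.
Qed.

Lemma hsum_norm_ge (x : hsum) j : `|x j| <= `|x|.
Proof.
rewrite -(@ler_pXn2r _ 2%N)// ?nnegrE// hsum_normE (bigD1 j)//= lerDl.
by apply: sumr_ge0 => k _; rewrite exprn_ge0.
Qed.

Lemma hsum_norm_le (x : hsum) : `|x| <= \sum_j `|x j|.
Proof.
have s0 : 0 <= \sum_j `|x j| by exact: sumr_ge0.
rewrite -(@ler_pXn2r _ 2%N)// ?nnegrE// hsum_normE expr2 mulr_suml.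
apply: ler_sum => j _; rewrite expr2 ler_wpM2l//.
by rewrite (bigD1 j)//= lerDl sumr_ge0.
Qed.

Lemma hsum_complete (G : set_system hsum) :
  ProperFilter G -> cauchy G -> cvg G.
Proof.
move=> GG /cauchyP Gc.
have Gj j : cvg ((fun x : hsum => x j) @ G).
  apply/cauchy_cvgP/cauchy_exP => e e0; have [x Gx] := Gc e e0.
  exists (x j); rewrite /fmap /=.
  apply: (@filterS _ G _ (ball x e)) Gx => y; rewrite -!ball_normE /=.
  by apply: le_lt_trans; have := hsum_norm_ge (x - y) j; rewrite !ffunE.
apply/cvg_ex; exists [ffun j => lim ((fun x : hsum => x j) @ G)].
apply/cvgrPdist_lt => e e0.
have e1 : 0 < e / d.+1%:R by rewrite divr_gt0.
pose l j := lim ((fun x : hsum => x j) @ G).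
have Gl j : G [set x : hsum | `|l j - x j| < e / d.+1%:R].
  by have /cvgrPdist_lt/(_ _ e1) := Gj j.
have : G [set x : hsum | forall j, `|l j - x j| < e / d.+1%:R].
  exact: filter_forall.
apply: filterS => x xl; apply: (le_lt_trans (hsum_norm_le _)).
apply: (@le_lt_trans _ _ (\sum_(j < d) e / d.+1%:R)).
  by apply: ler_sum => j _; rewrite !ffunE; exact/ltW/xl.
rewrite sumr_const card_ord -[_ *+ d]mulr_natr mulrAC -mulrA.
by rewrite gtr_pMr// ltr_pdivrMr// mul1r ltr_nat.
Qed.

HB.instance Definition _ := Uniform_isComplete.Build hsum hsum_complete.

Lemma hsum_inner_norm (x : hsum) : hsum_dot x x = `|x| ^+ 2.
Proof. by rewrite [RHS]sqrtCK. Qed.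

HB.instance Definition _ :=
  CompleteNormedModule_isHilbert.Build R hsum hsum_inner_norm.

End HilbertSum.


Section BoundedOperators.
Variables (R : realType) (E F : hilbertType R).

Definition bounded_linear (f : E -> F) : Prop :=
  linear f /\ exists M : R[i], forall x, `|f x| <= M * `|x|.

Definition bounded_linear_pred : {pred (E -> F)} :=
  fun f => `[< bounded_linear f >].

Record bop := BOp { bop_fun :> E -> F; _ : bop_fun \in bounded_linear_pred }.

HB.instance Definition _ := [isSub for bop_fun].
HB.instance Definition _ := [Choice of bop by <:].

Lemma bounded_linear_submod_closed : submod_closed bounded_linear_pred.
Proof.
split=> [|a f g]; rewrite !unfold_in.
  apply/asboolP; split=> [a x y|]; first by rewrite /= scaler0 addr0.
  by exists 0 => x; rewrite /= mul0r normr0.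
move=> /asboolP[fl [M fM]] /asboolP[gl [N gN]]; apply/asboolP; split.
  move=> c x y; rewrite /= !fctE.
  rewrite fl gl !scalerDr !scalerA [a * c]mulrC -!addrA; congr (_ + _).
  by rewrite addrCA.
exists (`|a| * M + N) => x; rewrite !fctE.
rewrite mulrDl (le_trans (ler_normD _ _))// lerD// normrZ -mulrA.
by rewrite ler_wpM2l.
Qed.
HB.instance Definition _ := GRing.isSubmodClosed.Build _ _ bounded_linear_pred
  bounded_linear_submod_closed.
HB.instance Definition _ := [SubChoice_isSubLmodule of bop by <:].

Lemma bopP (T : bop) : bounded_linear T.
Proof. by case: T => f fP /=; apply/asboolP. Qed.

HB.instance Definition _ (T : bop) :=
  GRing.isLinear.Build R[i] E F *:%R T (bopP T).1.

Definition to_bop (f : E -> F) (fP : bounded_linear f) : bop :=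
  BOp (introT (asboolP _) fP).

Definition opnorm_set (T : bop) : set R :=
  [set complex.Re `|T x| | x in [set x : E | `|x| <= 1]].

(* The norm of a normedModType R[i] has values in R[i]. *)
Definition opnorm (T : bop) : R[i] := (sup (opnorm_set T))%:C%C.

Implicit Types (S T : bop) (x : E) (a : R[i]).

Lemma opnorm_set0 T : opnorm_set T 0.
Proof. by exists 0; rewrite /= ?normr0 ?ler01// linear0 normr0. Qed.

Lemma Re_norm (V : normedModType R[i]) (x : V) : (complex.Re `|x|)%:C%C = `|x|.
Proof. by apply: RRe_real; exact: normr_real. Qed.

Lemma opnorm_set_ubound T (M : R[i]) : 0 <= M ->
  (forall x, `|T x| <= M * `|x|) -> ubound (opnorm_set T) (complex.Re M).
Proof.
move=> M0 TM _ [x /= x1 <-].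
rewrite -lecR Re_norm RRe_real ?ger0_real//.
by rewrite (le_trans (TM x))// -[leRHS]mulr1 ler_wpM2l.
Qed.

Lemma bop_bound T : exists2 M : R[i], 0 <= M & forall x, `|T x| <= M * `|x|.
Proof.
have [_ [M TM]] := bopP T; exists `|M| => // x.
have [->|x0] := eqVneq x 0; first by rewrite linear0 !normr0 mulr0.
have Mr : 0 <= M * `|x| by exact: le_trans (TM x).
by rewrite -[X in _ <= _ * X]normr_id -normrM ger0_norm.
Qed.

Lemma opnorm_has_sup T : has_sup (opnorm_set T).
Proof.
split; first by exists 0; exact: opnorm_set0.
by have [M M0 TM] := bop_bound T; exists (complex.Re M); exact: opnorm_set_ubound.
Qed.

Lemma opnorm_ge0 T : 0 <= opnorm T.
Proof.
by rewrite /opnorm ler0c; apply: sup_upper_bound (opnorm_has_sup T) _ (opnorm_set0 T).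
Qed.

Lemma opnormP T x : `|T x| <= opnorm T * `|x|.
Proof.
have [->|x0] := eqVneq x 0; first by rewrite linear0 !normr0 mulr0.
have x_gt0 : 0 < `|x| by rewrite normr_gt0.
rewrite -ler_pdivrMr// mulrC -[`|x|^-1]gtr0_norm ?invr_gt0// -normrZ -linearZ.
rewrite -Re_norm /opnorm lecR.
apply: sup_upper_bound (opnorm_has_sup T) _ _.
exists (`|x|^-1 *: x) => //=.
by rewrite normrZ normfV normr_id mulVf ?gt_eqF.
Qed.

Lemma opnorm_le T (M : R[i]) : 0 <= M -> (forall x, `|T x| <= M * `|x|) ->
  opnorm T <= M.
Proof.
move=> M0 TM; rewrite -[M]RRe_real ?ger0_real// /opnorm lecR.
apply: ge_sup; first by exists 0; exact: opnorm_set0.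
exact: opnorm_set_ubound.
Qed.

Lemma opnormD S T : opnorm (S + T) <= opnorm S + opnorm T.
Proof.
apply: opnorm_le => [|x]; first by rewrite addr_ge0// opnorm_ge0.
by rewrite mulrDl (le_trans (ler_normD _ _))// lerD// opnormP.
Qed.

Lemma opnormZ_le a T : opnorm (a *: T) <= `|a| * opnorm T.
Proof.
apply: opnorm_le => [|x]; first by rewrite mulr_ge0// opnorm_ge0.
by rewrite normrZ -mulrA ler_wpM2l// opnormP.
Qed.

Lemma opnormZ a T : opnorm (a *: T) = `|a| * opnorm T.
Proof.
apply/eqP; rewrite eq_le opnormZ_le /=.
have [->|a0] := eqVneq a 0; first by rewrite normr0 mul0r opnorm_ge0.
rewrite -ler_pdivlMl ?normr_gt0// -normfV.
by rewrite (le_trans _ (opnormZ_le _ _))// scalerA mulVf// scale1r.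
Qed.

Lemma opnorm_eq0 T : opnorm T = 0 -> T = 0.
Proof.
move=> T0; apply/val_inj/funext => x; apply/eqP.
by rewrite -normr_le0 (le_trans (opnormP _ _))// T0 mul0r.
Qed.

HB.instance Definition _ :=
  Lmodule_isNormed.Build R[i] bop opnormD opnormZ opnorm_eq0.

End BoundedOperators.

Section Operators.
Variable R : realType.
Implicit Types E F G : hilbertType R.

Lemma bcomp_subproof E F G (S : bop F G) (T : bop E F) :
  bounded_linear (S \o T).
Proof.
split=> [a x y|]; first by rewrite /= !linearP.
have [M M0 SM] := bop_bound S; have [N N0 TN] := bop_bound T.
exists (M * N) => x /=; rewrite (le_trans (SM _))// -mulrA.
by rewrite ler_wpM2l.
Qed.
Definition bcomp E F G (S : bop F G) (T : bop E F) : bop E G :=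
  to_bop (bcomp_subproof S T).

Lemma bid_subproof E : bounded_linear (@id E).
Proof. by split=> //; exists 1 => x; rewrite mul1r. Qed.
Definition bid E : bop E E := to_bop (bid_subproof E).

(* The adjoint is characterised by the condition below and exists by the Riesz
   representation theorem; the default value 0 is never reached. *)
Definition adj E F (T : bop E F) : bop F E :=
  xget 0 [set S : bop _ _ | forall x y, inner (T x) y = inner x (S y)].

(* Equal to 0 when T is not invertible. *)
Definition opinv E (T : bop E E) : bop E E :=
  xget 0 [set S : bop _ _ | bcomp S T = bid E /\ bcomp T S = bid E].

Definition isometric E F (T : bop E F) : Prop := forall x, `|T x| = `|x|.

Definition lin_subspace (V : normedModType R[i]) (M : set V) : Prop :=
  M 0 /\ forall (a : R[i]) x y, M x -> M y -> M (a *: x + y).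

Definition closed_span (V : normedModType R[i]) (X : set V) : set V :=
  smallest [set M | closed M /\ lin_subspace M] X.

Definition separable_space E : Prop := exists2 A : set E, countable A & dense A.

(* N is meant to be a closed subspace, the initial space of T. *)
Definition partial_isometry E F (T : bop E F) (N : set E) : Prop :=
  (forall x, N x -> `|T x| = `|x|) /\
  (forall x, (forall y, N y -> inner x y = 0) -> T x = 0).

Definition unital_closed_algebra E (X : set (bop E E)) : Prop :=
  [/\ closed X, lin_subspace X, X (bid E)
    & forall S T, X S -> X T -> X (bcomp S T)].

Definition norm_closed_algebra E (X : set (bop E E)) : set (bop E E) :=
  smallest (@unital_closed_algebra E) X.

(* The norm closure of X + X^*. *)
Definition add_adj E (X : set (bop E E)) : set (bop E E) :=
  closure [set A + adj B | A in X & B in X].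

(* Positivity of the n x n operator matrix A acting on the n-fold sum of E. *)
Definition psd E n (A : 'I_n -> 'I_n -> bop E E) : Prop :=
  forall x : 'I_n -> E, 0 <= \sum_i \sum_j inner (A i j (x j)) (x i).

Definition completely_positive E H (X : set (bop E E)) (phi : X -> bop H H) :
    Prop :=
  (forall (a : R[i]) (S T U : X), val U = a *: val S + val T ->
     phi U = a *: phi S + phi T) /\
  (forall n (A : 'I_n -> 'I_n -> X), psd (fun i j => val (A i j)) ->
     psd (fun i j => phi (A i j))).

End Operators.

Section RowOperators.
Variables (R : realType) (d : nat).
Implicit Types E F : hilbertType R.

Definition hsum_map E F (T : bop E F) (x : hsum d E) : hsum d F :=
  [ffun j => T (x j)].

Definition hsum_inj E (j : 'I_d) (x : E) : hsum d E :=
  [ffun k => if k == j then x else 0].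

(* The word i_1 ... i_k acts as T_{i_1} ... T_{i_k}, where T_j is the restriction
   of T to the j-th summand. *)
Definition row_word E (T : bop (hsum d E) E) (alpha : seq 'I_d) (x : E) : E :=
  foldr (fun j y => T (hsum_inj j y)) x alpha.

End RowOperators.

Section Ball.
Variables (R : realType) (d : nat).

Definition unit_ball : set 'rV[R[i]]_d :=
  [set z | \sum_j `|z 0 j| ^+ 2 < 1].

Lemma unit_ball0 : 0 \in unit_ball.
Proof.
apply/mem_set; rewrite /unit_ball /= big1 ?ltr01// => j _.
by rewrite mxE normr0 expr0n.
Qed.

Definition ball0 : unit_ball := exist _ 0 unit_ball0.

Definition cdot (z w : 'rV[R[i]]_d) : R[i] := \sum_j z 0 j * (w 0 j)^*.

End Ball.

(* A space of H-valued functions on X: f stands for the function sending x to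
   rk_ev x f, and rk_ext says that f is determined by its values. *)
Record rkhs (R : realType) (X : Type) (H : hilbertType R)
    (K : X -> X -> bop H H) := RKHS {
  rk_space :> hilbertType R;
  rk_ev : X -> bop rk_space H;
  rk_ext : forall f g, (forall x, rk_ev x f = rk_ev x g) -> f = g;
  rk_kernel : forall z w, bcomp (rk_ev z) (adj (rk_ev w)) = K z w }.

Section Kernels.
Variables (R : realType) (d : nat) (H : hilbertType R).
Local Notation B := (@unit_ball R d).

Definition szego (z w : B) : bop H H := (1 - cdot (val z) (val w))^-1 *: bid H.

Definition multiplier_ball (H2 : rkhs szego) (b : B -> bop H H) : Prop :=
  exists2 M : bop H2 H2, `|M| <= 1
    & forall f z, rk_ev H2 z (M f) = b z (rk_ev H2 z f).

Variable b : B -> bop H H.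

Definition herglotz (z : B) : bop H H :=
  bcomp (opinv (bid H - b z)) (bid H + b z).

Definition herglotz_kernel (z w : B) : bop H H :=
  (2^-1 / (1 - cdot (val z) (val w))) *: (herglotz z + adj (herglotz w)).

Variable Lb : rkhs herglotz_kernel.

(* K_w *)
Definition kfun (w : B) : bop H Lb := adj (rk_ev Lb w).

(* w^* K_w h *)
Definition wstar_kfun (w : B) (h : H) : hsum d Lb :=
  [ffun j => (val w 0 j)^* *: kfun w h].

Definition herglotz_init : set (hsum d Lb) :=
  closed_span [set wstar_kfun w h | w in setT & h in setT].

Definition is_herglotz_isometry (V : bop (hsum d Lb) Lb) : Prop :=
  partial_isometry V herglotz_init /\
  forall w h, V (wstar_kfun w h) = kfun w h - kfun (ball0 R d) h.

End Kernels.
Arguments herglotz_init {R d H b} Lb.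

(* fock_basis (i_1 ... i_k) is the elementary tensor of the standard basis vectors
   e_{i_1}, ..., e_{i_k} of C^d; the empty word gives the vacuum vector. *)
Record full_fock (R : realType) (d : nat) := FullFock {
  fock_space :> hilbertType R;
  fock_basis : seq 'I_d -> fock_space;
  fock_orthonormal : forall alpha beta,
    inner (fock_basis alpha) (fock_basis beta) = (alpha == beta)%:R;
  fock_total : closed_span (range fock_basis) = setT;
  creation : 'I_d -> bop fock_space fock_space;
  creationE : forall j alpha,
    creation j (fock_basis alpha) = fock_basis (j :: alpha) }.

Section FreeDisk.
Variables (R : realType) (d : nat) (F : full_fock R d).
Implicit Types z w : 'rV[R[i]]_d.

(* L w^* *)
Definition Lstar w : bop F F := \sum_j (w 0 j)^* *: creation F j.

(* z L^* *)
Definition starL z : bop F F := \sum_j z 0 j *: adj (creation F j).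

Definition free_disk_algebra : set (bop F F) :=
  norm_closed_algebra (range (creation F)).

Definition szego_span : set (bop F F) :=
  closed_span [set opinv (bid F - Lstar z) | z in @unit_ball R d].

End FreeDisk.
Arguments free_disk_algebra {R d} F.
Arguments szego_span {R d} F.

Section Extensions.
Variables (R : realType) (d : nat) (H : hilbertType R).
Variable b : @unit_ball R d -> bop H H.

Definition is_mu (F : full_fock R d)
    (mu : add_adj (szego_span F) -> bop H H) : Prop :=
  completely_positive mu /\
  forall (z w : @unit_ball R d) (x : add_adj (szego_span F)),
    val x = bcomp (opinv (bid F - starL F (val z)))
                  (opinv (bid F - Lstar F (val w))) ->
    mu x = herglotz_kernel b z w.

Definition cp_extension (F : full_fock R d)
    (mu : add_adj (szego_span F) -> bop H H) : Type :=
  {phi : add_adj (free_disk_algebra F) -> bop H H |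
    completely_positive phi /\
    forall (x : add_adj (szego_span F)) (y : add_adj (free_disk_algebra F)),
      val x = val y -> phi y = mu x}.

Variables (Lb : rkhs (herglotz_kernel b)) (V : bop (hsum d Lb) Lb).

(* An element of Ext(V); the inclusion of Lb in the larger space is the isometric
   embedding ext_emb, along which ext_op agrees with V on herglotz_init. *)
Record isometric_extension := IsometricExtension {
  ext_space : hilbertType R;
  ext_emb : bop Lb ext_space;
  ext_emb_isometry : isometric ext_emb;
  ext_op : bop (hsum d ext_space) ext_space;
  ext_isometry : isometric ext_op;
  ext_extends : forall x, herglotz_init Lb x ->
    ext_op (hsum_map ext_emb x) = ext_emb (V x);
  ext_cyclic : closed_span
    [set row_word ext_op alpha (ext_emb (kfun Lb (ball0 R d) h))
       | alpha in setT & h in setT] = setT }.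

Definition ext_equiv (D1 D2 : isometric_extension) : Prop :=
  exists U : bop (ext_space D1) (ext_space D2),
    [/\ isometric U, range U = setT,
        forall x, U (ext_op D1 x) = ext_op D2 (hsum_map U x)
      & forall f, U (ext_emb D1 f) = ext_emb D2 f].

Definition ext_class : Type :=
  {C : isometric_extension -> Prop | exists D, C = ext_equiv D}.

End Extensions.

(* Main.v *)
Require Import Defs.
From HB Require Import structures.
From mathcomp Require Import all_boot all_order all_algebra.
From mathcomp Require Import complex ring lra.
From mathcomp Require Import boolp classical_sets functions cardinality reals.
From mathcomp Require Import topology normedtype sequences.
Set Implicit Arguments.
Unset Strict Implicit.
Unset Printing Implicit Defensive.
Import Order.TTheory GRing.Theory Num.Theory.
Import numFieldNormedType.Exports.
Local Open Scope classical_set_scope.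
Local Open Scope ring_scope.

(** The correspondence sends a completely positive extension [phi] of [mu_b] to the
    class of the extensions [D] of [V] whose moments [K_0^* D^alpha K_0] are the
    operators [phi (L^alpha)].  It is a bijection because both sides are determined
    by their moments and the same families of moments occur on both sides.

    Moments determine [phi]: the free disk algebra is the closed span of the words
    [L^alpha] (free_disk_algebra_words), and completely positive maps are
    continuous and commute with adjoints (cp_on_eq).  Moments determine [D] up to
    equivalence: the components of a [d]-isometry satisfy [D_i^* D_j = delta_ij], so
    that the Gram matrix of the cyclic vectors [D^alpha K_0 h] reduces to moments,
    and families with equal Gram matrices are unitarily equivalent
    (ext_equiv_moment).

    From [phi] to [D]: because [L_i^* L_j = delta_ij], the products
    [L^alpha^* L^beta] lie in the operator system, and [phi] defines a positive
    kernel on words tensored with [H].  Its GNS space carries a [d]-isometry [D],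
    namely prefixing of letters (row_isometric_dilation).  The space is obtained
    inside the Fock space by a Cholesky factorisation of the kernel, which is
    possible since [H] is separable.  The resolvents of [D] applied to the copy of
    [H] have the inner products prescribed by the Herglotz kernel, because [phi]
    extends [mu_b]; mapping [K_w h] to them embeds the Herglotz space, and the
    resolvent equation says precisely that [D] extends [V] (extension_of_cp).

    From [D] to [phi]: one has to know that [L^alpha |-> D^alpha] extends to a
    completely positive map, to be compressed to [K_0 H].  This map is a pointwise
    limit of truncated Poisson transforms, that is, of sums of matrix coefficients
    against the Gram matrix of the vectors [r^k Delta D^alpha^* x], with [k] the
    length of [alpha] and [Delta] the square root of [I - r^2 DD^*]; each of them
    is completely positive by the Schur product theorem.  As [DD^*] is a
    projection, [Delta] is an explicit combination of projections
    (row_isometric_cp_map).  The compression agrees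
    with [mu_b] on the generators of the smaller operator system since
    the resolvent of [D] at [w] maps [K_0 h] to [K_w h] (cp_extension_of). *)

(** * Inner products, sequences and closed spans *)

Section Inner.
Variables (R : realType) (E : hilbertType R).
Local Notation C := R[i].
Implicit Types (x y z : E) (a : C).

Lemma innerDl x y z : inner (x + y) z = inner x z + inner y z.
Proof. exact: linearDl. Qed.

Lemma innerDr x y z : inner z (x + y) = inner z x + inner z y.
Proof. exact: linearDr. Qed.

Lemma innerBl x y z : inner (x - y) z = inner x z - inner y z.
Proof. exact: linearBl. Qed.

Lemma innerBr x y z : inner z (x - y) = inner z x - inner z y.
Proof. exact: linearBr. Qed.

Lemma innerZl a x y : inner (a *: x) y = a * inner x y.
Proof. exact: linearZl_LR. Qed.

Lemma innerZr a x y : inner x (a *: y) = a^* * inner x y.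
Proof. exact: linearZr_LR. Qed.

Lemma inner0l x : inner 0 x = 0. Proof. exact: linear0l. Qed.
Lemma inner0r x : inner x 0 = 0. Proof. exact: linear0r. Qed.

Lemma innerC x y : inner x y = (inner y x)^*.
Proof. by rewrite hermC mul1r. Qed.

Lemma inner_ge0 x : 0 <= inner x x. Proof. exact: dnorm_ge0. Qed.

Lemma inner_suml I (r : seq I) (P : pred I) (F : I -> E) y :
  inner (\sum_(i <- r | P i) F i) y = \sum_(i <- r | P i) inner (F i) y.
Proof. exact: (linear_sumlz (inner : {dot E for @Num.conj R[i]})). Qed.

Lemma inner_sumr I (r : seq I) (P : pred I) (F : I -> E) y :
  inner y (\sum_(i <- r | P i) F i) = \sum_(i <- r | P i) inner y (F i).
Proof. exact: linear_sumr. Qed.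

Lemma inner_le_norm x y : `|inner x y| <= `|x| * `|y|.
Proof.
rewrite -(@ler_pXn2r _ 2%N)// ?nnegrE ?mulr_ge0// exprMn -!inner_norm.
exact: dot_CauchySchwarz.
Qed.

Lemma inner_inj x y : (forall z, inner x z = inner y z) -> x = y.
Proof.
move=> xy; apply/eqP; rewrite -subr_eq0.
rewrite -(dnorm_eq0 (inner : {dot E for @Num.conj R[i]})).
by rewrite innerBl xy subrr.
Qed.

Lemma norm_inner x y : (inner x x <= inner y y) = (`|x| <= `|y|).
Proof. by rewrite !inner_norm ler_pXn2r// nnegrE. Qed.

Lemma norm_inner_eq (F : hilbertType R) x (y : F) :
  inner x x = inner y y -> `|x| = `|y|.
Proof. by rewrite !inner_norm => /eqP; rewrite eqrXn2// => /eqP. Qed.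

End Inner.

Section Sequences.
Variable R : realType.
Local Notation C := R[i].

(** The order of [R[i]] is partial, but positive elements are real, so that the
    Archimedean property of [R] applies to real parts. *)
Lemma natSinv_lt (e : C) : 0 < e ->
  exists N, forall n, (N <= n)%N -> n.+1%:R^-1 < e :> C.
Proof.
move=> e0; have Ree : (complex.Re e)%:C%C = e by rewrite RRe_real// gtr0_real.
have Re0 : 0 < complex.Re e by rewrite -ltcR Ree.
have Ni : (complex.Re e)^-1 < (Num.bound (complex.Re e)^-1)%:R.
  by apply: archi_boundP; rewrite invr_ge0 ltW.
exists (Num.bound (complex.Re e)^-1) => n Nn.
rewrite -Ree -(rmorph_nat (real_complex R)) -fmorphV ltcR.
rewrite -[ltRHS]invrK ltf_pV2 ?posrE ?invr_gt0//.
by apply: (lt_trans Ni); rewrite ltr_nat.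
Qed.

Variable V : normedModType C.
Implicit Types (M : set V) (x : V) (u v : nat -> V).

Lemma closure_seq M x : closure M x ->
  exists u, (forall n, M (u n)) /\ u @ \oo --> x.
Proof.
move=> Mx.
have /choice[u Mu] n : exists y, M y /\ `|x - y| < n.+1%:R^-1.
  have [|y []] := Mx (ball x n.+1%:R^-1); first by apply: nbhsx_ballx; rewrite invr_gt0.
  by rewrite -ball_normE /= => ? ?; exists y.
exists u; split=> [n|]; first by have [] := Mu n.
apply/cvgrPdist_lt => e /natSinv_lt[N Ne]; exists N => //= n /Ne.
by apply: lt_trans; have [] := Mu n.
Qed.

Lemma closed_seq M : (forall u x, (forall n, M (u n)) -> u @ \oo --> x -> M x) ->
  closed M.
Proof. by move=> Mu x /closure_seq[u [/Mu]]; exact. Qed.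

Lemma cvg_distP u x : (forall e : C, 0 < e -> exists N, forall n, (N <= n)%N -> `|x - u n| < e) ->
  u @ \oo --> x.
Proof.
move=> h; apply/cvgrPdist_lt => e /h[N Ne]; exists N => //= n; exact: Ne.
Qed.

Lemma cvg_dist u x : u @ \oo --> x ->
  forall e : C, 0 < e -> exists N, forall n, (N <= n)%N -> `|x - u n| < e.
Proof. by move=> /cvgrPdist_lt h e /h[N _ Ne]; exists N => n /Ne. Qed.

Lemma cvg_le_dist u x (s : nat -> C) :
  (forall e : C, 0 < e -> exists N, forall n, (N <= n)%N -> s n < e) ->
  (forall n, `|x - u n| <= s n) -> u @ \oo --> x.
Proof.
move=> s0 xu; apply: cvg_distP => e /s0[N Ne]; exists N => n /Ne.
exact: le_lt_trans.
Qed.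

End Sequences.

Section LipschitzLimits.
Variable R : realType.
Local Notation C := R[i].

Lemma cvg_lip (V W : normedModType C) (f : V -> W) (c : C) u x :
  (forall x y, `|f x - f y| <= c * `|x - y|) ->
  u @ \oo --> x -> f \o u @ \oo --> f x.
Proof.
move=> fc ux; apply: cvg_distP => e e0.
have [N Ne] := cvg_dist ux (divr_gt0 e0 (ltr_pwDr ltr01 (normr_ge0 c))).
exists N => n /Ne; rewrite ltr_pdivlMr ?ltr_pwDr// mulrC; apply: le_lt_trans.
have [->|xun] := eqVneq x (u n); first by rewrite /= !subrr !normr0 mulr0.
rewrite (le_trans (fc _ _))//.
have c0 : 0 <= c.
  have := le_trans (normr_ge0 _) (fc x (u n)).
  by rewrite pmulr_lge0// normr_gt0 subr_eq0.
by rewrite ler_pM2r ?normr_gt0 ?subr_eq0// ger0_norm// lerDl.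
Qed.

End LipschitzLimits.

Section CompleteSequences.
Variable R : realType.
Local Notation C := R[i].

Lemma cauchy_seq_cvg (V : completeNormedModType C) (u : nat -> V) :
  (forall e : C, 0 < e ->
     exists N, forall m n, (N <= m)%N -> (N <= n)%N -> `|u m - u n| < e) ->
  exists x : V, u @ \oo --> x.
Proof.
move=> uc; have /cvg_ex// : cvg (u @ \oo); apply/cauchy_cvgP; apply/cauchy_exP => e /uc[N Ne].
exists (u N), N => //= n Nn; rewrite -ball_normE /=; exact: Ne.
Qed.

(** Used to see that a limit of points of a graph is again in its domain: an image
    sequence is Cauchy because its increments are dominated by those of a
    convergent sequence. *)
Lemma cauchy_le (V W : normedModType C) (u : nat -> V) (v : nat -> W) (y : W)
    (c : C) : 0 <= c -> v @ \oo --> y ->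
  (forall m n, `|u m - u n| <= c * `|v m - v n|) ->
  forall e : C, 0 < e ->
    exists N, forall m n, (N <= m)%N -> (N <= n)%N -> `|u m - u n| < e.
Proof.
move=> c0 vy uv e e0.
have c1 : 0 < c + 1 by rewrite ltr_pwDr.
have e1 : 0 < e / (c + 1) / 2 by rewrite !divr_gt0.
have [N Ne] := cvg_dist vy e1; exists N => m n Nm Nn.
apply: (le_lt_trans (uv m n)); apply: (@le_lt_trans _ _ ((c + 1) * `|v m - v n|)).
  by rewrite ler_wpM2r// lerDl.
rewrite mulrC -ltr_pdivlMr// [ltRHS]splitr.
have -> : v m - v n = (y - v n) - (y - v m) by rewrite opprB [RHS]addrC addrA subrK.
by rewrite (le_lt_trans (ler_normB _ _))// ltrD// Ne.
Qed.

End CompleteSequences.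

Section LinearBop.
Variables (R : realType) (E F : hilbertType R).
Implicit Types (S T : bop E F) (x y : E).

Lemma bop0 T : T 0 = 0. Proof. exact: linear0. Qed.
Lemma bopD T x y : T (x + y) = T x + T y. Proof. exact: linearD. Qed.
Lemma bopB T x y : T (x - y) = T x - T y. Proof. exact: linearB. Qed.
Lemma bopZ T a x : T (a *: x) = a *: T x. Proof. exact: linearZ. Qed.
Lemma bopsum T I (r : seq I) (P : pred I) (f : I -> E) :
  T (\sum_(i <- r | P i) f i) = \sum_(i <- r | P i) T (f i).
Proof. exact: linear_sum. Qed.

Lemma bopDE S T x : (S + T) x = S x + T x. Proof. by []. Qed.
Lemma bopBE S T x : (S - T) x = S x - T x. Proof. by []. Qed.
Lemma bopZE a T x : (a *: T) x = a *: T x. Proof. by []. Qed.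
Lemma bopsumE I (r : seq I) (P : pred I) (f : I -> bop E F) x :
  (\sum_(i <- r | P i) f i) x = \sum_(i <- r | P i) f i x.
Proof. by apply: (big_morph (fun T => bop_fun T x)). Qed.

Lemma bopE S T : (forall x, S x = T x) -> S = T.
Proof. by move=> ST; apply/val_inj/funext. Qed.

Lemma bop_norm_le T x : `|T x| <= `|T| * `|x|. Proof. exact: opnormP. Qed.

End LinearBop.

Section Continuity.
Variable R : realType.
Local Notation C := R[i].
Implicit Types E F : hilbertType R.

Lemma cvg_bop E F (T : bop E F) (u : nat -> E) x :
  u @ \oo --> x -> (fun n => T (u n)) @ \oo --> T x.
Proof.
apply: (@cvg_lip _ _ _ T (opnorm T)) => y z.
by rewrite -bopB; exact: opnormP.
Qed.

Lemma cvg_inner E (u v : nat -> E) x y :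
  u @ \oo --> x -> v @ \oo --> y ->
  (fun n => inner (u n) (v n) : C^o) @ \oo --> (inner x y : C^o).
Proof.
move=> ux vy; apply/cvgrPdist_lt => e e0.
have [Nv Hv] := cvg_dist vy (@ltr01 C).
have e1 : 0 < e / 2 / (`|x| + 1) by rewrite !divr_gt0// ltr_pwDr.
have e2 : 0 < e / 2 / (`|y| + 1) by rewrite !divr_gt0// ltr_pwDr.
have [N1 H1] := cvg_dist vy e1; have [N2 H2] := cvg_dist ux e2.
exists (maxn Nv (maxn N1 N2)) => // n; rewrite /= !geq_max => /and3P[/Hv nv /H1 n1 /H2 n2].
have -> : inner x y - inner (u n) (v n) = inner x (y - v n) + inner (x - u n) (v n).
  by rewrite innerBr innerBl addrA subrK.
rewrite (le_lt_trans (ler_normD _ _))// [ltRHS]splitr ltrD//.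
  rewrite (le_lt_trans (inner_le_norm _ _))//.
  apply: (@le_lt_trans _ _ ((`|x| + 1) * `|y - v n|)).
    by rewrite ler_wpM2r// lerDl.
  by rewrite mulrC -ltr_pdivlMr// ltr_pwDr.
rewrite (le_lt_trans (inner_le_norm _ _))//.
apply: (@le_lt_trans _ _ (`|x - u n| * (`|y| + 1))).
  rewrite ler_wpM2l// -[v n](subrK y) addrC (le_trans (ler_normD _ _))// lerD2l.
  by rewrite -normrN opprB ltW.
by rewrite -ltr_pdivlMr// ltr_pwDr.
Qed.

Lemma cvgC_unique (u : nat -> C^o) (a b : C^o) : u @ \oo --> a -> u @ \oo --> b -> a = b.
Proof. by move=> ua ub; apply: (cvg_unique _ ua ub); exact: norm_hausdorff. Qed.

Lemma cvgV_unique (V : normedModType C) (u : nat -> V) (a b : V) :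
  u @ \oo --> a -> u @ \oo --> b -> a = b.
Proof. by move=> ua ub; apply: (cvg_unique _ ua ub); exact: norm_hausdorff. Qed.

(** In [R[i]] the relation [0 <= a] amounts to [`|a| = a], a closed condition. *)
Lemma cvg_ge0 (u : nat -> C^o) (a : C) :
  u @ \oo --> (a : C^o) -> (forall n, 0 <= u n) -> 0 <= a.
Proof.
move=> ua u0.
have na : `|a| = a.
  apply: (@cvgC_unique (fun n => `|u n|)); first exact: cvg_norm.
  by have -> : (fun n => `|u n|) = u by apply/funext => n; rewrite ger0_norm.
by rewrite -na.
Qed.

End Continuity.

Section ClosedSubspaces.
Variable R : realType.
Local Notation C := R[i].

Section One.
Variable V : normedModType C.
Implicit Types (M X : set V) (x : V).

Lemma lin_sub0 M : lin_subspace M -> M 0. Proof. by case. Qed.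

Lemma lin_subZ M a x : lin_subspace M -> M x -> M (a *: x).
Proof. by move=> [M0 MD] Mx; rewrite -[a *: x]addr0; exact: MD. Qed.

Lemma lin_subD M x y : lin_subspace M -> M x -> M y -> M (x + y).
Proof. by move=> [M0 MD] Mx My; rewrite -[x]scale1r; exact: MD. Qed.

Lemma lin_subB M x y : lin_subspace M -> M x -> M y -> M (x - y).
Proof.
by move=> Ml Mx My; apply: lin_subD => //; rewrite -scaleN1r; exact: lin_subZ.
Qed.

Lemma lin_sub_sum M I (r : seq I) (P : pred I) (f : I -> V) : lin_subspace M ->
  (forall i, P i -> M (f i)) -> M (\sum_(i <- r | P i) f i).
Proof.
move=> Ml Mf; apply: (big_ind (fun x => M x)) => //; first exact: lin_sub0.
by move=> x y; exact: lin_subD.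
Qed.

Lemma closed_span_sub X : X `<=` closed_span X.
Proof. exact: sub_smallest. Qed.

Lemma closed_span_min X M : closed M -> lin_subspace M -> X `<=` M ->
  closed_span X `<=` M.
Proof. by move=> cM lM XM; exact: smallest_sub. Qed.

Lemma in_closed M (u : nat -> V) x : closed M -> (forall n, M (u n)) ->
  u @ \oo --> x -> M x.
Proof. by move=> cM Mu; apply: closed_cvg => //; exact: nearW. Qed.

Lemma closed_span_closed X : closed (closed_span X).
Proof.
apply: closed_seq => u x Xu ux M /= [[cM lM] XM].
by apply: (in_closed cM _ ux) => n; exact: Xu.
Qed.

Lemma closed_span_lin X : lin_subspace (closed_span X).
Proof.
split=> [|a x y Xx Xy] M /= [[cM lM] XM]; first exact: lM.1.
by apply: lM.2; [exact: Xx|exact: Xy].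
Qed.

Lemma closure_lin M : lin_subspace M -> lin_subspace (closure M).
Proof.
move=> Ml; split; first by apply: subset_closure; exact: lin_sub0.
move=> a x y /closure_seq[u [Mu ux]] /closure_seq[v [Mv vy]].
apply: (in_closed (@closed_closure _ M) _ (cvgD (cvgZl_tmp (k := a) ux) vy)) => n.
by apply: subset_closure; apply: Ml.2.
Qed.

End One.

Lemma total_inner_inj (E : hilbertType R) (X : set E) (x y : E) :
  closed_span X = setT -> (forall z, X z -> inner x z = inner y z) -> x = y.
Proof.
move=> Xt xy; apply: inner_inj => z; have : closed_span X z by rewrite Xt.
move: z; apply: (closed_span_min (M := [set z | inner x z = inner y z])) => //.
  apply: closed_seq => u z uz cuz.
  apply: cvgC_unique (cvg_inner (cvg_cst x) cuz) _.
  under eq_fun do rewrite uz; exact: cvg_inner (cvg_cst y) cuz.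
split=> [|a z w /= zxy wxy]; first by rewrite /= !inner0r.
by rewrite /= !innerDr !innerZr zxy wxy.
Qed.

Lemma bop_eq_closed_span (E F : hilbertType R) (X : set E) (S T : bop E F) z :
  (forall z, X z -> S z = T z) -> closed_span X z -> S z = T z.
Proof.
move=> ST; move: z; apply: (closed_span_min (M := [set z | S z = T z])) => //.
  apply: closed_seq => u z uz cuz; rewrite /=; apply: (cvgV_unique (cvg_bop (T := S) cuz)).
  under eq_fun do rewrite uz; exact: cvg_bop.
split=> [|a z w /= zST wST]; first by rewrite /= !bop0.
by rewrite /= !bopD !bopZ zST wST.
Qed.

Lemma total_bop_eq (E F : hilbertType R) (X : set E) (S T : bop E F) :
  closed_span X = setT -> (forall z, X z -> S z = T z) -> S = T.
Proof.
by move=> Xt ST; apply: bopE => z; apply: bop_eq_closed_span ST _; rewrite Xt.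
Qed.

End ClosedSubspaces.

(** * Riesz representation, adjoints, completeness of operator spaces *)

Section Riesz.
Variables (R : realType) (E : hilbertType R).
Local Notation C := R[i].

Let sq (x : E) : R := complex.Re (inner x x).

Let sqE x : (sq x)%:C%C = inner x x.
Proof. by rewrite RRe_real// ger0_real// inner_ge0. Qed.

Let sq_norm x : (sq x)%:C%C = `|x| ^+ 2.
Proof. by rewrite sqE inner_norm. Qed.

Let sq_ge0 x : 0 <= sq x.
Proof. by rewrite -ler0c sqE inner_ge0. Qed.

Lemma parallelogram (x y : E) :
  inner (x - y) (x - y) + inner (x + y) (x + y) = 2 * inner x x + 2 * inner y y.
Proof. by rewrite !innerBl !innerBr !innerDl !innerDr; ring. Qed.

Let sq_parallelogram x y : sq (x - y) + sq (x + y) = 2 * sq x + 2 * sq y.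
Proof.
by apply/complexI; rewrite !(rmorphD, rmorphM, rmorph1) /= !sqE parallelogram.
Qed.

Let sqZ (a : R) x : sq (a%:C%C *: x) = a ^+ 2 * sq x.
Proof.
apply/complexI; rewrite rmorphM rmorphXn /= !sqE innerZl innerZr mulrA.
by have /CrealP -> : a%:C%C \is Num.real by rewrite complex_real.
Qed.

Variable f : E -> C.
Hypothesis f_lin : forall a x y, f (a *: x + y) = a * f x + f y.
Variable M : C.
Hypothesis f_bound : forall x, `|f x| <= M * `|x|.

Let f0 : f 0 = 0.
Proof. by have := f_lin (-1) 0 0; rewrite scaler0 addr0 mulN1r addNr. Qed.
Let fD x y : f (x + y) = f x + f y.
Proof. by rewrite -[x]scale1r f_lin mul1r scale1r. Qed.
Let fZ a x : f (a *: x) = a * f x.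
Proof. by rewrite -[a *: x]addr0 f_lin f0 addr0. Qed.
Let fB x y : f (x - y) = f x - f y.
Proof. by rewrite fD -scaleN1r fZ mulN1r. Qed.

(** The affine hyperplane [f = 1] has a point of least norm, because a minimizing
    sequence is Cauchy by the parallelogram law. *)
Lemma riesz_least : (exists x, f x != 0) ->
  exists2 x0, f x0 = 1 & forall x, f x = 1 -> `|x0| <= `|x|.
Proof.
move=> [x1 fx1]; pose D := [set sq x | x in [set x | f x = 1]].
have D0 : has_inf D.
  split; last by exists 0 => _ [x _ <-].
  by exists (sq ((f x1)^-1 *: x1)), ((f x1)^-1 *: x1) => //=; rewrite fZ mulVf.
have sqD x : f x = 1 -> inf D <= sq x.
  by move=> fx; apply: ge_inf; [exact: D0.2|exists x].
have /choice[u Hu] n : exists x, f x = 1 /\ sq x < inf D + n.+1%:R^-1.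
  have [|_ [x fx <-] xn] := @inf_adherent _ D n.+1%:R^-1 _ D0; first by rewrite invr_gt0.
  by exists x.
(* The midpoint of [x] and [y] lies on the hyperplane as well, so that the
   parallelogram law bounds the distance of two almost minimal points. *)
have mid x y : f x = 1 -> f y = 1 -> sq (x - y) <= 2 * (sq x - inf D) + 2 * (sq y - inf D).
  move=> fx fy; have : inf D <= sq ((2^-1 : R)%:C%C *: (x + y)).
    apply: sqD; rewrite fZ fD fx fy fmorphV rmorph_nat -[1 + 1]/2%:R.
    by rewrite mulVf// pnatr_eq0.
  rewrite sqZ; have := sq_parallelogram x y; lra.
have [x0 ux0] : exists x0 : E, u @ \oo --> x0.
  apply: cauchy_seq_cvg => e e0.
  have e1 : 0 < e ^+ 2 / 4 by rewrite divr_gt0// exprn_gt0.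
  have [N Ne] := natSinv_lt e1; exists N => m n Nm Nn.
  rewrite -(@ltr_pXn2r _ 2%N)// ?nnegrE ?(ltW e0)// -sq_norm.
  have [[fm um] [fn un]] := (Hu m, Hu n).
  have mn : sq (u m - u n) < 2 * m.+1%:R^-1 + 2 * n.+1%:R^-1.
    move: (mid _ _ fm fn) um un; move: (m.+1%:R^-1) (n.+1%:R^-1) => p q.
    move: (sq _) (sq _) (sq _) (inf D) => s1 s2 s3 s4; lra.
  apply: (@lt_trans _ _ (2 * m.+1%:R^-1 + 2 * n.+1%:R^-1)).
    by move: mn; rewrite -ltcR rmorphD !rmorphM /= !fmorphV !rmorph_nat.
  have -> : e ^+ 2 = 2 * (e ^+ 2 / 4) + 2 * (e ^+ 2 / 4) by field.
  by rewrite ltrD// ltr_pM2l// Ne.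
exists x0.
  apply: (@cvgC_unique _ (f \o u)).
    apply: (@cvg_lip _ _ (C^o) (f : E -> C^o) M _ _ _ ux0) => x y.
    by rewrite -fB f_bound.
  have -> : f \o u = cst 1 by apply/funext => n /=; have [] := Hu n.
  exact: cvg_cst.
move=> x fx; rewrite -norm_inner -!sqE lecR.
apply: le_trans (sqD _ fx).
rewrite -lecR sqE -subr_ge0.
apply: (@cvg_ge0 _ (fun n => ((inf D)%:C%C + n.+1%:R^-1) - inner (u n) (u n) : C^o)).
  apply: cvgB; last exact: cvg_inner.
  rewrite -[X in _ --> X]addr0; apply: cvgD; first exact: cvg_cst.
  apply: cvg_distP => e /natSinv_lt[N Ne]; exists N => n /Ne.
  by rewrite sub0r normrN ger0_norm// invr_ge0.
move=> n; rewrite subr_ge0 -sqE; have [_ /ltW] := Hu n.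
by rewrite -lecR rmorphD /= fmorphV rmorph_nat.
Qed.

(** A point of least norm on [f = 1] is orthogonal to the kernel of [f], hence
    represents [f] up to a scalar. *)
Lemma riesz : exists y, forall x, f x = inner x y.
Proof.
have [/riesz_least[x0 fx0 x0min]|nf] := pselect (exists x, f x != 0); last first.
  exists 0 => x; rewrite inner0r; apply/eqP/negP => /negP fx; apply: nf.
  by exists x.
have ker v : f v = 0 -> inner v x0 = 0.
  move=> fv; apply/eqP; apply/negP => /negP vx0.
  have v0 : v != 0 by apply: contraNneq vx0 => ->; rewrite inner0l.
  have vv : 0 < inner v v by rewrite dnorm_gt0.
  (* Moving [x0] along [v] to its closest point to the origin would shorten it. *)
  pose c := inner x0 v / inner v v.
  have : `|x0| <= `|x0 - c *: v| by apply: x0min; rewrite fB fZ fv mulr0 subr0.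
  rewrite -norm_inner innerBl !innerBr !innerZl !innerZr.
  have -> : inner v x0 = (inner x0 v)^* by rewrite innerC.
  have -> : c^* = (inner x0 v)^* / inner v v.
    rewrite rmorphM fmorphV; congr (_ / _); apply/CrealP.
    by rewrite ger0_real// inner_ge0.
  move: vx0; rewrite innerC fmorph_eq0.
  rewrite /c; move: (inner x0 x0) (inner x0 v) (inner v v) vv => A p D D0 /negP p0.
  have -> : A - p^* / D * p - (p / D * p^* - p / D * (p^* / D * D)) = A - p * p^* / D.
    by field; rewrite gt_eqF.
  rewrite -subr_ge0 addrAC subrr sub0r oppr_ge0 pmulr_lle0 ?invr_gt0// -normCK => h.
  by apply: p0; rewrite -normr_eq0 -sqrf_eq0 eq_le h exprn_ge0.
have x00 : x0 != 0.
  by apply/eqP => x00; move: fx0; rewrite x00 f0 => /eqP; rewrite eq_sym oner_eq0.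
have x0x0 : 0 < inner x0 x0 by rewrite dnorm_gt0.
exists ((inner x0 x0)^-1 *: x0) => x.
have /eqP : inner (x - f x *: x0) x0 = 0 by apply: ker; rewrite fB fZ fx0 mulr1 subrr.
rewrite innerBl innerZl subr_eq0 => /eqP xx0.
rewrite innerZr xx0.
have -> : ((inner x0 x0)^-1)^* = (inner x0 x0)^-1.
  by apply/CrealP; rewrite ger0_real// invr_ge0 inner_ge0.
by rewrite mulrC mulfK// gt_eqF.
Qed.

End Riesz.

Section Adjoint.
Variable R : realType.
Local Notation C := R[i].
Implicit Types E F G : hilbertType R.

(** Riesz representation of the functionals [x |-> inner (T x) y]. *)
Lemma adj_exists E F (T : bop E F) :
  exists S : bop F E, forall x y, inner (T x) y = inner x (S y).
Proof.
have /choice[g gP] y : exists z, forall x, inner (T x) y = inner x z.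
  apply: (@riesz _ _ (fun x => inner (T x) y) _ (`|T| * `|y|)) => [a u v|x].
    by rewrite bopD bopZ innerDl innerZl.
  by rewrite mulrAC (le_trans (inner_le_norm _ _))// ler_wpM2r// bop_norm_le.
have gb : bounded_linear g.
  split=> [a u v|].
    apply: inner_inj => z; rewrite innerC [RHS]innerC; congr (_^*).
    by rewrite -gP innerDr innerZr !gP innerDr innerZr.
  exists `|T| => y; have [->|gy] := eqVneq (g y) 0; first by rewrite normr0 mulr_ge0.
  rewrite -(ler_pM2l (_ : 0 < `|g y|)) ?normr_gt0// -expr2 -inner_norm -gP.
  have -> : inner (T (g y)) y = `|inner (T (g y)) y|.
    by rewrite ger0_norm// gP inner_ge0.
  by rewrite mulrCA mulrA (le_trans (inner_le_norm _ _))// ler_wpM2r// bop_norm_le.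
by exists (to_bop gb) => x y; rewrite gP.
Qed.

Lemma adjP E F (T : bop E F) x y : inner (T x) y = inner x (adj T y).
Proof.
have [S TS] := adj_exists T.
exact: (@xgetPex _ 0 [set S : bop _ _ | forall x y, inner (T x) y = inner x (S y)]
  (ex_intro _ S TS)).
Qed.

Lemma adjPr E F (T : bop E F) x y : inner x (T y) = inner (adj T x) y.
Proof. by rewrite innerC adjP -innerC. Qed.

Lemma adj_uniq E F (T : bop E F) (S : bop F E) :
  (forall x y, inner (T x) y = inner x (S y)) -> adj T = S.
Proof.
move=> TS; apply: bopE => y; apply: inner_inj => x.
by rewrite innerC [RHS]innerC -adjP TS.
Qed.

Lemma adjK E F (T : bop E F) : adj (adj T) = T.
Proof. by apply: adj_uniq => x y; rewrite adjPr. Qed.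

Lemma adj_linear E F a (S T : bop E F) : adj (a *: S + T) = a^* *: adj S + adj T.
Proof.
by apply: adj_uniq => x y; rewrite !bopDE !bopZE innerDl innerDr innerZl innerZr conjCK !adjP.
Qed.

Lemma adjD E F (S T : bop E F) : adj (S + T) = adj S + adj T.
Proof. by rewrite -[S]scale1r adj_linear rmorph1 !scale1r. Qed.

Lemma adj0 E F : adj (0 : bop E F) = 0.
Proof. by apply: adj_uniq => x y; rewrite /= inner0l inner0r. Qed.

Lemma adjZ E F a (S : bop E F) : adj (a *: S) = a^* *: adj S.
Proof. by rewrite -[a *: S]addr0 adj_linear adj0 addr0. Qed.

Lemma adjB E F (S T : bop E F) : adj (S - T) = adj S - adj T.
Proof. by rewrite adjD -scaleN1r adjZ rmorphN rmorph1 scaleN1r. Qed.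

Lemma adj_comp E F G (S : bop F G) (T : bop E F) :
  adj (bcomp S T) = bcomp (adj T) (adj S).
Proof. by apply: adj_uniq => x y; rewrite /= -!adjP. Qed.

Lemma adj_id E : adj (bid E) = bid E.
Proof. by apply: adj_uniq. Qed.

Lemma opnorm_inner E F (T : bop E F) c : 0 <= c ->
  (forall x y, `|inner (T x) y| <= c * `|x| * `|y|) -> `|T| <= c.
Proof.
move=> c0 Tc; apply: opnorm_le => // x.
have [->|Tx] := eqVneq (T x) 0; first by rewrite normr0 mulr_ge0.
rewrite -(ler_pM2r (_ : 0 < `|T x|)) ?normr_gt0//.
by rewrite (le_trans _ (Tc x (T x)))// inner_norm ger0_norm ?exprn_ge0.
Qed.

Lemma adj_norm E F (T : bop E F) : `|adj T| <= `|T|.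
Proof.
apply: opnorm_inner => // x y; rewrite -adjPr (le_trans (inner_le_norm _ _))//.
by rewrite mulrC mulrAC ler_wpM2r// bop_norm_le.
Qed.

Lemma bcomp_norm E F G (S : bop F G) (T : bop E F) : `|bcomp S T| <= `|S| * `|T|.
Proof.
apply: opnorm_le => [|x /=]; first by rewrite mulr_ge0.
by rewrite (le_trans (bop_norm_le _ _))// -mulrA ler_wpM2l// bop_norm_le.
Qed.

Lemma bid_norm E : `|bid E| <= 1.
Proof. by apply: opnorm_le => // x /=; rewrite mul1r. Qed.

Lemma bcompZr E F G (S : bop F G) a (T : bop E F) :
  bcomp S (a *: T) = a *: bcomp S T.
Proof. by apply: bopE => x; exact: bopZ. Qed.

Lemma bcompDr E F G (S : bop F G) (T1 T2 : bop E F) :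
  bcomp S (T1 + T2) = bcomp S T1 + bcomp S T2.
Proof. by apply: bopE => x; exact: bopD. Qed.

Lemma bcomp_sumr E F G (S : bop F G) I (r : seq I) (P : pred I) (f : I -> bop E F) :
  bcomp S (\sum_(i <- r | P i) f i) = \sum_(i <- r | P i) bcomp S (f i).
Proof. by apply: bopE => x; rewrite /= !bopsumE bopsum. Qed.

Lemma cvg_adj E F (u : nat -> bop E F) (T : bop E F) :
  u @ \oo --> T -> (fun n => adj (u n)) @ \oo --> adj T.
Proof.
apply: (@cvg_lip _ _ _ (@adj R E F) 1) => S S'.
by rewrite -adjB mul1r adj_norm.
Qed.

Lemma cvg_bcompr E F G (S : bop F G) (u : nat -> bop E F) (T : bop E F) :
  u @ \oo --> T -> (fun n => bcomp S (u n)) @ \oo --> bcomp S T.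
Proof.
apply: (@cvg_lip _ _ _ (fun T => bcomp S T) `|S|) => T1 T2.
have -> : bcomp S T1 - bcomp S T2 = bcomp S (T1 - T2).
  by apply: bopE => x; rewrite /= bopB.
exact: bcomp_norm.
Qed.

Lemma cvg_bcompl E F G (S : bop E F) (u : nat -> bop F G) (T : bop F G) :
  u @ \oo --> T -> (fun n => bcomp (u n) S) @ \oo --> bcomp T S.
Proof.
apply: (@cvg_lip _ _ _ (fun T => bcomp T S) `|S|) => T1 T2.
have -> : bcomp T1 S - bcomp T2 S = bcomp (T1 - T2) S by apply: bopE.
by rewrite mulrC bcomp_norm.
Qed.

Lemma cvg_bop_app E F (u : nat -> bop E F) (T : bop E F) x :
  u @ \oo --> T -> (fun n => u n x) @ \oo --> T x.
Proof.
apply: (@cvg_lip _ _ _ (fun T : bop E F => T x) `|x|) => T1 T2.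
by rewrite mulrC; exact: bop_norm_le.
Qed.

(** The pointwise limit of a Cauchy sequence of operators is a bounded operator,
    and the convergence is uniform on the unit ball. *)
Lemma bop_complete E F (u : nat -> bop E F) :
  (forall e : C, 0 < e ->
     exists N, forall m n, (N <= m)%N -> (N <= n)%N -> `|u m - u n| < e) ->
  exists T : bop E F, u @ \oo --> T.
Proof.
move=> uc.
have /choice[g ug] x : exists y : F, (fun n => u n x) @ \oo --> y.
  apply: cauchy_seq_cvg => e e0.
  have [N Ne] := uc _ (divr_gt0 e0 (ltr_pwDr ltr01 (normr_ge0 x))).
  exists N => m n Nm Nn; have := Ne m n Nm Nn.
  rewrite ltr_pdivlMr ?ltr_pwDr//; apply: le_lt_trans.
  by rewrite (le_trans (bop_norm_le (u m - u n) x))// ler_wpM2l// lerDl.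
have lim_le x (c : C) N y : (forall n, (N <= n)%N -> `|u n x - y| <= c) -> `|g x - y| <= c.
  move=> xy; rewrite -subr_ge0.
  apply: (@cvg_ge0 _ (fun n => c - `|u (n + N)%N x - y| : C^o)); last first.
    by move=> n; rewrite subr_ge0 xy// leq_addl.
  apply: cvgB; first exact: cvg_cst.
  apply: cvg_norm; apply: cvgB; last exact: cvg_cst.
  by have := ug x; rewrite -(cvg_shiftn N).
have [N1 H1] := uc 1 ltr01.
have gb : bounded_linear g.
  split=> [a x y|].
    apply: (@cvgV_unique _ F (fun n => u n (a *: x + y))); first exact: ug.
    have -> : (fun n => u n (a *: x + y)) = (fun n => a *: u n x + u n y).
      by apply/funext => n; rewrite bopD bopZ.
    exact: cvgD (cvgZl_tmp (k := a) (ug x)) (ug y).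
  exists (1 + `|u N1|) => x; rewrite -[g x](subrK (u N1 x)) mulrDl.
  rewrite (le_trans (ler_normD _ _))// lerD ?bop_norm_le//.
  apply: (lim_le _ _ N1) => n Nn; rewrite (le_trans (bop_norm_le (u n - u N1) x))//.
  by rewrite ler_wpM2r// ltW// H1.
exists (to_bop gb); apply: cvg_distP => e e0.
have e1 : 0 < e / 2 by rewrite divr_gt0.
have [N Ne] := uc _ e1; exists N => n Nn.
apply: (@le_lt_trans _ _ (e / 2)); last by rewrite gtr_pMr// invf_lt1// ltr1n.
apply: opnorm_le => [|x]; first exact: ltW.
apply: (lim_le _ _ N) => m Nm; rewrite (le_trans (bop_norm_le (u m - u n) x))//.
by rewrite ler_wpM2r// ltW// Ne.
Qed.

End Adjoint.

(** * Isometries determined by Gram matrices, Neumann series *)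

Section Isometries.
Variable R : realType.
Local Notation C := R[i].
Implicit Types E F : hilbertType R.

(** Polarization: compare the norms of [U z] and [z] for [z = x + y] and for
    [z = x + i y]. *)
Lemma isometric_inner E F (U : bop E F) x y :
  isometric U -> inner (U x) (U y) = inner x y.
Proof.
move=> Uiso; have Uxx z : inner (U z) (U z) = inner z z by rewrite !inner_norm Uiso.
have h1 := Uxx (x + y); have h2 := Uxx (x + 'i *: y).
move: h1; rewrite bopD !innerDl !innerDr !Uxx => h1.
move: h2; rewrite bopD bopZ !innerDl !innerDr !innerZl !innerZr !Uxx conjCi => h2.
move: h1 h2; set p := inner (U x) _; set q := inner (U y) (U x).
set p' := inner x y; set q' := inner y x => h1 h2.
have pq : (p - p') + (q - q') = 0.
  by move/eqP: h1; rewrite -subr_eq0 => /eqP <-; ring.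
have qp : (q - q') = (p - p').
  apply: (@mulfI _ 'i); first exact: neq0Ci.
  apply/eqP; rewrite -subr_eq0; apply/eqP.
  by move/eqP: h2; rewrite -subr_eq0 => /eqP <-; ring.
move: pq; rewrite qp -mulr2n => /eqP; rewrite mulrn_eq0 /= subr_eq0 => /eqP //.
Qed.

(** Let [G] be the closed span of the pairs [(x i, y i)].  The equality of the
    Gram matrices passes to [G], so that [G] is the graph of an isometry; its
    domain is closed because preimages of a convergent sequence under the first
    projection form a Cauchy sequence. *)
Lemma isometry_extension E F (I : Type) (x : I -> E) (y : I -> F) :
  closed_span (range x) = setT ->
  (forall i j, inner (x i) (x j) = inner (y i) (y j)) ->
  exists U : bop E F, isometric U /\ forall i, U (x i) = y i.
Proof.
move=> xt xy; pose X : set (E * F)%type := range (fun i => (x i, y i)).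
pose G := closed_span X.
have Glin : lin_subspace G := closed_span_lin X.
have Gcl : closed G := @closed_span_closed _ _ X.
have cvg1 (u : nat -> (E * F)%type) (p : (E * F)%type) :
    u @ \oo --> p -> (fun n => (u n).1) @ \oo --> p.1.
  by move=> up; apply: (cvg_comp _ _ up cvg_fst).
have cvg2 (u : nat -> (E * F)%type) (p : (E * F)%type) :
    u @ \oo --> p -> (fun n => (u n).2) @ \oo --> p.2.
  by move=> up; apply: (cvg_comp _ _ up cvg_snd).
have G1 p i : G p -> inner p.1 (x i) = inner p.2 (y i).
  move: p; apply: (closed_span_min
    (M := [set p : (E * F)%type | inner p.1 (x i) = inner p.2 (y i)])).
  - apply: closed_seq => u p up cup.
    apply: cvgC_unique (cvg_inner (cvg1 _ _ cup) (cvg_cst (x i))) _.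
    under eq_fun do rewrite up; exact: cvg_inner (cvg2 _ _ cup) (cvg_cst (y i)).
  - split=> [|a p q /= pi qi]; first by rewrite /= !inner0l.
    by rewrite /= !innerDl !innerZl pi qi.
  - by move=> _ [j _ <-] /=.
have G2 p q : G p -> G q -> inner p.1 q.1 = inner p.2 q.2.
  move=> Gp; move: q; apply: (closed_span_min
    (M := [set q : (E * F)%type | inner p.1 q.1 = inner p.2 q.2])).
  - apply: closed_seq => u q uq cuq.
    apply: cvgC_unique (cvg_inner (cvg_cst p.1) (cvg1 _ _ cuq)) _.
    under eq_fun do rewrite uq; exact: cvg_inner (cvg_cst p.2) (cvg2 _ _ cuq).
  - split=> [|a r q /= ri qi]; first by rewrite /= !inner0r.
    by rewrite /= !innerDr !innerZr ri qi.
  - by move=> _ [j _ <-] /=; exact: G1.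
have Gnorm p : G p -> `|p.2| = `|p.1|.
  by move=> Gp; apply: norm_inner_eq; rewrite G2.
have Gfun a b c : G (a, b) -> G (a, c) -> b = c.
  move=> Gb Gc; have /= := Gnorm _ (lin_subB Glin Gb Gc).
  by rewrite subrr normr0 => /eqP; rewrite normr_eq0 subr_eq0 => /eqP.
have dom a : exists b, G (a, b).
  have : closed_span (range x) a by rewrite xt.
  move: a; apply: (closed_span_min (M := [set a | exists b, G (a, b)])).
  - apply: closed_seq => u a /choice[v Guv] ua.
    have [b vb] : exists b : F, v @ \oo --> b.
      apply: cauchy_seq_cvg; apply: (cauchy_le (c := 1) _ ua) => // m n.
      by rewrite mul1r (Gnorm _ (lin_subB Glin (Guv m) (Guv n))).
    exists b; apply: (in_closed Gcl Guv); exact: cvg_pair.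
  - split=> [|c a a' [b Gb] [b' Gb']]; first by exists 0; exact: (lin_sub0 Glin).
    by exists (c *: b + b'); exact: (Glin.2 c _ _ Gb Gb').
  - by move=> _ [i _ <-]; exists (y i); apply: closed_span_sub; exists i.
have [U GU] := choice dom.
have Ub : bounded_linear U.
  split=> [a b c|]; last by exists 1 => a; rewrite mul1r (Gnorm _ (GU a)).
  by apply: (Gfun _ _ _ (GU _)); exact: (Glin.2 a _ _ (GU b) (GU c)).
exists (to_bop Ub); split=> [a|i]; first exact: (Gnorm _ (GU a)).
by apply: (Gfun _ _ _ (GU _)); apply: closed_span_sub; exists i.
Qed.

Lemma unitary_extension E F (I : Type) (x : I -> E) (y : I -> F) :
  closed_span (range x) = setT -> closed_span (range y) = setT ->
  (forall i j, inner (x i) (x j) = inner (y i) (y j)) ->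
  exists U : bop E F, [/\ isometric U, range U = setT & forall i, U (x i) = y i].
Proof.
move=> xt yt xy; have [U [Uiso Ux]] := isometry_extension xt xy.
have [W [_ Wy]] := isometry_extension yt (fun i j => esym (xy i j)).
exists U; split=> //; rewrite -subTset => b _; exists (W b) => //.
transitivity (bcomp U W b) => //.
suff -> : bcomp U W = bid F by [].
apply: (total_bop_eq yt) => _ [i _ <-] /=.
by rewrite Wy Ux.
Qed.

End Isometries.

Section Neumann.
Variable R : realType.
Local Notation C := R[i].

Lemma expr_lt_eps (c e : C) : 0 <= c -> c < 1 -> 0 < e ->
  exists N, forall n, (N <= n)%N -> c ^+ n < e.
Proof.
move=> c0 c1 e0.
have Ree : (complex.Re e)%:C%C = e by rewrite RRe_real// gtr0_real.
have Rec : (complex.Re c)%:C%C = c by rewrite RRe_real// ger0_real.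
have c1' : `|complex.Re c| < 1.
  by rewrite ger0_norm; [rewrite -ltcR Rec|rewrite -ler0c Rec].
have e0' : 0 < complex.Re e by rewrite -ltcR Ree.
have /cvgrPdist_lt/(_ _ e0')[N _ Ne] := cvg_expr c1'.
exists N => n /Ne; rewrite /= sub0r normrN -ltcR Ree -{2}Rec -rmorphXn /=.
by apply: le_lt_trans; rewrite lecR ler_norm.
Qed.

Variable E : hilbertType R.
Implicit Types S T : bop E E.

Definition bpow T n : bop E E := iter n (bcomp T) (bid E).
Arguments bpow : simpl never.

Lemma bpowSr T n : bpow T n.+1 = bcomp (bpow T n) T.
Proof.
elim: n => [|n IH]; first by apply: bopE => x; rewrite /bpow /=.
by rewrite -[LHS]/(bcomp T (bpow T n.+1)) {1}IH; apply: bopE.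
Qed.

Lemma bpow_norm T n : `|bpow T n| <= `|T| ^+ n.
Proof.
elim: n => [|n IH]; first by rewrite expr0 bid_norm.
by rewrite exprS (le_trans (bcomp_norm _ _))// ler_wpM2l.
Qed.

Lemma opinv_uniq S T : bcomp S T = bid E -> bcomp T S = bid E -> opinv T = S.
Proof.
move=> ST TS; have [S'T _] := @xgetPex _ 0
  [set S : bop E E | bcomp S T = bid E /\ bcomp T S = bid E]
  (ex_intro _ S (conj ST TS)).
rewrite -/(opinv T) in S'T.
transitivity (bcomp (opinv T) (bcomp T S)); first by rewrite TS; apply: bopE.
transitivity (bcomp (bcomp (opinv T) T) S); first by apply: bopE.
by rewrite S'T; apply: bopE.
Qed.

(** The partial sums are Cauchy by comparison with a geometric series, and their
    limit is a two-sided inverse because [1 - T^n] tends to [1]. *)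
Lemma neumann T : `|T| < 1 ->
  [/\ bcomp (opinv (bid E - T)) (bid E - T) = bid E,
      bcomp (bid E - T) (opinv (bid E - T)) = bid E
    & (fun n => \sum_(k < n) bpow T k) @ \oo --> opinv (bid E - T)].
Proof.
move=> T1; have c0 : 0 < 1 - `|T| by rewrite subr_gt0.
pose s n := \sum_(k < n) bpow T k.
have pow0 : (fun n => bpow T n) @ \oo --> (0 : bop E E).
  apply: (@cvg_le_dist _ _ _ _ (fun n => `|T| ^+ n)) => [e|n].
    exact: expr_lt_eps.
  by rewrite sub0r normrN bpow_norm.
(* The tail of the geometric series from index [n] on. *)
pose v n : C := `|T| ^+ n / (1 - `|T|).
have v_ge0 n : 0 <= v n by rewrite /v divr_ge0 ?exprn_ge0// ltW.
have v0 : (v : nat -> C^o) @ \oo --> (0 : C^o).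
  apply: (@cvg_le_dist _ _ _ _ v) => [e e0|n]; last first.
    by rewrite sub0r normrN ger0_norm.
  have [N Ne] := expr_lt_eps (normr_ge0 T) T1 (mulr_gt0 e0 c0).
  by exists N => n /Ne; rewrite /v ltr_pdivrMr.
have step n k : `|s (n + k)%N - s n| <= v n - v (n + k)%N.
  elim: k => [|k IH]; first by rewrite addn0 !subrr normr0.
  rewrite addnS {1}/s big_ord_recr /= -/(s _) addrAC.
  rewrite (le_trans (ler_normD _ _))//.
  have -> : v n - v (n + k).+1 = (v n - v (n + k)%N) + (v (n + k)%N - v (n + k).+1).
    by rewrite addrA subrK.
  rewrite lerD// /v -mulrBl exprSr -{1}[_ ^+ (n + k)]mulr1 -mulrBr.
  by rewrite mulfK ?gt_eqF// bpow_norm.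
have [S sS] : exists S : bop E E, s @ \oo --> S.
  apply: bop_complete; apply: (cauchy_le (c := 1) _ v0) => // m n; rewrite mul1r.
  have [|/ltnW] := leqP n m => /subnKC <-.
    by rewrite (le_trans (step _ _))// distrC real_ler_norm// rpredB// ger0_real.
  rewrite distrC (le_trans (step _ _))// real_ler_norm// rpredB// ger0_real//.
have left1 : bcomp S (bid E - T) = bid E.
  apply: cvgV_unique (cvg_bcompl (S := bid E - T) sS) _.
  have -> : (fun n => bcomp (s n) (bid E - T)) = fun n => bid E - bpow T n.
    apply/funext => n; elim: n => [|n IH].
      by rewrite /s big_ord0; apply: bopE => x; rewrite bopBE subrr.
    rewrite {1}/s big_ord_recr /= -/(s n) bpowSr.
    have -> : bcomp (s n + bpow T n) (bid E - T) =
        bcomp (s n) (bid E - T) + bcomp (bpow T n) (bid E - T) by apply: bopE.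
    rewrite IH; apply: bopE => x.
    by rewrite !(bopDE, bopBE) /= ?bopBE ?bopB /= addrA subrK.
  by rewrite -[X in _ --> X]subr0; apply: cvgB; first exact: cvg_cst.
have right1 : bcomp (bid E - T) S = bid E.
  apply: cvgV_unique (cvg_bcompr (S := bid E - T) sS) _.
  have -> : (fun n => bcomp (bid E - T) (s n)) = fun n => bid E - bpow T n.
    apply/funext => n; elim: n => [|n IH].
      rewrite /s big_ord0; apply: bopE => x.
      by rewrite [RHS]bopBE subrr; exact: (bop0 (bid E - T)).
    rewrite {1}/s big_ord_recr /= -/(s n).
    have -> : bcomp (bid E - T) (s n + bpow T n) =
        bcomp (bid E - T) (s n) + bcomp (bid E - T) (bpow T n).
      by apply: bopE => x; exact: (bopD (bid E - T)).
    rewrite IH; apply: bopE => x.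
    by rewrite !(bopDE, bopBE) /= ?bopBE /= addrA subrK.
  by rewrite -[X in _ --> X]subr0; apply: cvgB; first exact: cvg_cst.
by rewrite (opinv_uniq left1 right1).
Qed.

Lemma closed_algebra_pow (A : set (bop E E)) T n :
  unital_closed_algebra A -> A T -> A (bpow T n).
Proof. by move=> [_ _ A1 AM] AT; elim: n => // n IH; exact: AM. Qed.

Lemma closed_algebra_resolvent (A : set (bop E E)) T :
  unital_closed_algebra A -> A T -> `|T| < 1 -> A (opinv (bid E - T)).
Proof.
move=> Aalg AT /neumann[_ _]; apply: in_closed => [|n]; first by case: Aalg.
apply: lin_sub_sum => [|k _]; first by case: Aalg.
exact: closed_algebra_pow.
Qed.

End Neumann.

(** * Positive kernels: Cholesky factorisation and Schur products *)

Section PositiveKernels.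
Variable R : realType.
Local Notation C := R[i].

Definition positive_kernel (X : Type) (k : X -> X -> C) : Prop :=
  (forall x y, k y x = (k x y)^*) /\
  forall s : seq (X * C),
    0 <= \sum_(p <- s) \sum_(q <- s) p.2 * (q.2)^* * k p.1 q.1.

Lemma positive_kernel_diag (X : Type) (k : X -> X -> C) x :
  positive_kernel k -> 0 <= k x x.
Proof.
by move=> [_ /(_ [:: (x, 1)])]; rewrite !big_seq1 /= rmorph1 !mul1r.
Qed.

Lemma positive_kernel_comp (X Y : Type) (f : Y -> X) (k : X -> X -> C) :
  positive_kernel k -> positive_kernel (fun y z => k (f y) (f z)).
Proof.
move=> [kC k0]; split=> // s; have := k0 [seq (f p.1, p.2) | p <- s].
by rewrite big_map; under eq_bigr do rewrite big_map.
Qed.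

Lemma gram_positive (X : Type) (E : hilbertType R) (v : X -> E) :
  positive_kernel (fun x y => inner (v x) (v y)).
Proof.
split=> [x y|s]; first exact: innerC.
have := inner_ge0 (\sum_(p <- s) p.2 *: v p.1).
rewrite inner_suml; under eq_bigr do rewrite inner_sumr.
by under eq_bigr do under eq_bigr do rewrite innerZl innerZr mulrA.
Qed.

(** One step of Gaussian elimination on the pivot [m]; a zero pivot leaves the
    kernel unchanged because [x / 0 = 0]. *)
Definition schur_complement (X : Type) (m : X) (k : X -> X -> C) : X -> X -> C :=
  fun x y => k x y - k x m * k m y / k m m.

(** The Cauchy-Schwarz inequality in the degenerate case. *)
Lemma pivot_eq0 (X : Type) (m x : X) (k : X -> X -> C) :
  positive_kernel k -> k m m = 0 -> k x m = 0.
Proof.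
move=> kp kmm; have kxx := positive_kernel_diag x kp; case: kp => kC k0.
apply/eqP/negP => /negP kxm.
have P0 : 0 < `|k x m| ^+ 2 by rewrite exprn_gt0// normr_gt0.
(* With this factor the quadratic form takes the value [- (k x x + 2)]. *)
pose r := (k x x + 1) / `|k x m| ^+ 2.
have rr : r^* = r.
  by apply/CrealP; rewrite ger0_real// divr_ge0 ?addr_ge0// ltW.
have := k0 [:: (x, 1); (m, - r * k x m)].
rewrite !big_cons !big_nil /= !addr0 !rmorphM !rmorphN /= rr rmorph1 kmm !mulr0 addr0.
rewrite (kC x m) !mul1r !mulr1.
have -> : k x x + - r * (k x m)^* * k x m + - r * k x m * (k x m)^* =
  k x x - 2 * (r * (k x m * (k x m)^*)) by ring.
rewrite -normCK divfK ?gt_eqF//.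
have -> : k x x - 2 * (k x x + 1) = - (k x x + 2) by ring.
rewrite oppr_ge0 => h.
by have := lt_le_trans (ltr_pwDr (ltr0n _ 2) kxx) h; rewrite ltxx.
Qed.

Lemma schur_complement_pivot (X : Type) (m x : X) (k : X -> X -> C) :
  positive_kernel k -> schur_complement m k x m = 0.
Proof.
move=> kp; rewrite /schur_complement; have [kmm|kmm] := eqVneq (k m m) 0.
  by rewrite (pivot_eq0 x kp kmm) !mul0r subrr.
by rewrite mulfK// subrr.
Qed.

Lemma schur_complement_positive (X : Type) (m : X) (k : X -> X -> C) :
  positive_kernel k -> positive_kernel (schur_complement m k).
Proof.
move=> kp; have kmm := positive_kernel_diag m kp; case: kp => kC k0.
have rr : (k m m)^* = k m m by rewrite -kC.
split=> [x y|s].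
  rewrite /schur_complement rmorphB /= 2!rmorphM /= fmorphV /= rr -!kC.
  by congr (_ - _ / _); rewrite mulrC.
have [k00|knz] := eqVneq (k m m) 0.
  have -> : schur_complement m k = k; last exact: k0.
  apply/funext => x; apply/funext => y.
  by rewrite /schur_complement k00 invr0 mulr0 subr0.
(* The quadratic form of the Schur complement at [s] is that of [k] at [s]
   corrected by the multiple of [m] that minimises it. *)
pose t := \sum_(p <- s) p.2 * k p.1 m.
have := k0 ((m, - (t / k m m)) :: s).
rewrite big_cons big_cons /=; under [X in _ + X]eq_bigr do rewrite big_cons /=.
rewrite big_split /=.
have -> : \sum_(j <- s) - (t / k m m) * (j.2)^* * k m j.1 = - (t / k m m) * t^*.
  rewrite /t rmorph_sum /= mulr_sumr; apply: eq_bigr => p _.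
  by rewrite rmorphM /= -kC mulrA.
have -> : \sum_(i <- s) i.2 * (- (t / k m m))^* * k i.1 m = - (t^* / k m m) * t.
  rewrite {3}/t mulr_sumr; apply: eq_bigr => p _.
  by rewrite rmorphN rmorphM /= fmorphV /= rr; ring.
rewrite rmorphN rmorphM /= fmorphV /= rr => h.
have -> : \sum_(p <- s) \sum_(q <- s) p.2 * (q.2)^* * schur_complement m k p.1 q.1 =
  \sum_(p <- s) \sum_(q <- s) p.2 * (q.2)^* * k p.1 q.1 - t * t^* / k m m.
  rewrite /t rmorph_sum /= mulr_suml mulr_suml -sumrB.
  apply: eq_bigr => p _; rewrite mulr_sumr mulr_suml -sumrB.
  by apply: eq_bigr => q _; rewrite /schur_complement rmorphM /= -kC; ring.
move: h; congr (0 <= _); field; exact: knz.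
Qed.

Lemma sum_ord_widen (V : zmodType) (f : nat -> V) i N : (i < N)%N ->
  (forall m, (i < m)%N -> f m = 0) -> \sum_(m < N) f m = \sum_(m < i.+1) f m.
Proof.
move=> iN f0; rewrite -!(big_mkord xpredT f) (big_cat_nat _ (n := i.+1))//=.
by rewrite [X in _ + X]big_nat [X in _ + X]big1 ?addr0// => m /andP[im _]; exact: f0.
Qed.

(** Cholesky factorisation: eliminating the pivots [0], [1], [2], ... subtracts one
    rank-one kernel at a time, and what is left after [N] steps vanishes on the
    first [N] rows. *)
Lemma gram_factorization (k : nat -> nat -> C) : positive_kernel k ->
  exists a : nat -> nat -> C, (forall i m, (i < m)%N -> a i m = 0) /\
    forall i j N, (i < N)%N -> k i j = \sum_(m < N) a i m * (a j m)^*.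
Proof.
move=> kp.
pose K := fix K m := if m is n.+1 then schur_complement n (K n) else k.
have Kp m : positive_kernel (K m).
  by elim: m => //= m IH; exact: schur_complement_positive.
have KC m i j : K m j i = (K m i j)^* by have [->] := Kp m.
have K0 m i j : (j < m)%N -> K m i j = 0.
  elim: m i j => // m IH i j; rewrite ltnS leq_eqVlt => /orP[/eqP ->|jm] /=.
    exact: schur_complement_pivot.
  by rewrite /schur_complement !(IH _ j)// mulr0 mul0r subrr.
have K0l m i j : (i < m)%N -> K m i j = 0 by move=> im; rewrite KC K0// rmorph0.
have kK N i j : k i j = \sum_(m < N) K m i m * K m m j / K m m m + K N i j.
  elim: N => [|N IH]; first by rewrite big_ord0 add0r.
  by rewrite IH big_ord_recr /= -addrA; congr (_ + _); rewrite /schur_complement addrC subrK.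
exists (fun i m => K m i m / sqrtC (K m m m)); split=> [i m im|i j N iN].
  by rewrite K0l// mul0r.
rewrite (kK N) (K0l N)// addr0; apply: eq_bigr => m _.
have Km : 0 <= sqrtC (K m m m) by rewrite sqrtC_ge0 positive_kernel_diag.
rewrite rmorphM /= fmorphV /=.
have -> : (sqrtC (K m m m))^* = sqrtC (K m m m).
  by apply/CrealP; rewrite ger0_real.
by rewrite -(KC m j m) mulrACA -invfM -expr2 sqrtCK.
Qed.

Definition orthonormal_seq (E : hilbertType R) (e : nat -> E) : Prop :=
  forall i j, inner (e i) (e j) = (i == j)%:R.

Lemma kernel_realization_nat (E : hilbertType R) (e : nat -> E)
    (k : nat -> nat -> C) :
  orthonormal_seq e -> positive_kernel k ->
  exists v : nat -> E, forall i j, inner (v i) (v j) = k i j.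
Proof.
move=> eo /gram_factorization[a [a0 ka]].
exists (fun i => \sum_(m < i.+1) a i m *: e m) => i j.
have vE l : (l < (maxn i j).+1)%N ->
    \sum_(m < l.+1) a l m *: e m = \sum_(m < (maxn i j).+1) a l m *: e m.
  move=> lN; rewrite [RHS](@sum_ord_widen _ (fun m => a l m *: e m) l)// => m lm.
  by rewrite a0// scale0r.
rewrite !vE ?ltnS ?leq_maxl ?leq_maxr// (ka i j (maxn i j).+1) ?ltnS ?leq_maxl//.
rewrite inner_suml; apply: eq_bigr => m _; rewrite inner_sumr (bigD1 m)//= big1 => [|l lm].
  by rewrite innerZl innerZr eo eqxx mulr1 addr0.
by rewrite innerZl innerZr eo eq_sym (negbTE (lm : l != m :> nat)) !mulr0.
Qed.

(** The vectors of the countable dense subset come from the Cholesky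
    factorisation, and the others are limits of these.  To see that the limits have the
    right inner products, compare with a factorisation in which two further points [x] and [y] were put
    in front. *)
Lemma kernel_realization (E : hilbertType R) (e : nat -> E) (X : Type)
    (k : X -> X -> C) (q : nat -> X) :
  orthonormal_seq e -> positive_kernel k ->
  (forall x (eps : C), 0 < eps ->
     exists n, k x x - k x (q n) - k (q n) x + k (q n) (q n) < eps) ->
  exists v : X -> E, forall x y, inner (v x) (v y) = k x y.
Proof.
move=> eo kp qd.
have [w0 w0k] := kernel_realization_nat eo (positive_kernel_comp q kp).
pose s x y n := if n is m.+1 then (if m is l.+1 then q l else y) else x.
have ws x y : exists w : nat -> E, forall i j,
    inner (w i) (w j) = k (s x y i) (s x y j).
  exact: kernel_realization_nat eo (positive_kernel_comp (s x y) kp).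
have /choice[f fP] x : exists f : nat -> nat, forall m,
    k x x - k x (q (f m)) - k (q (f m)) x + k (q (f m)) (q (f m)) < m.+1%:R^-1 ^+ 2.
  have /choice[g gP] m : exists n,
      k x x - k x (q n) - k (q n) x + k (q n) (q n) < m.+1%:R^-1 ^+ 2.
    by apply: qd; rewrite exprn_gt0// invr_gt0.
  by exists g.
have near x y (w : nat -> E) : (forall i j, inner (w i) (w j) = k (s x y i) (s x y j)) ->
    (fun m => w (f x m).+2) @ \oo --> w 0%N /\ (fun m => w (f y m).+2) @ \oo --> w 1%N.
  move=> wk; split; apply: (@cvg_le_dist _ _ _ _ (fun m => m.+1%:R^-1)).
  - exact: natSinv_lt.
  - move=> m; rewrite -(@ler_pXn2r _ 2%N)// ?nnegrE ?invr_ge0// -inner_norm.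
    by rewrite innerBl !innerBr !wk /= opprB addrA ltW// [ltLHS]addrAC fP.
  - exact: natSinv_lt.
  - move=> m; rewrite -(@ler_pXn2r _ 2%N)// ?nnegrE ?invr_ge0// -inner_norm.
    by rewrite innerBl !innerBr !wk /= opprB addrA ltW// [ltLHS]addrAC fP.
have /choice[v vP] x : exists z : E, (fun m => w0 (f x m)) @ \oo --> z.
  have [w wk] := ws x x; have [w0' _] := near _ _ _ wk.
  apply: cauchy_seq_cvg; apply: (cauchy_le (c := 1) _ w0') => // m n; rewrite mul1r.
  by rewrite (@norm_inner_eq _ _ _ _ (w (f x m).+2 - w (f x n).+2))//
    !innerBl !innerBr !w0k !wk.
exists v => x y; have [w wk] := ws x y; have [wx wy] := near _ _ _ wk.
apply: cvgC_unique (cvg_inner (vP x) (vP y)) _.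
have -> : (fun n => inner (w0 (f x n)) (w0 (f y n)) : C^o) =
    fun n => inner (w (f x n).+2) (w (f y n).+2).
  by apply/funext => n; rewrite w0k wk.
by rewrite -[k x y](wk 0%N 1%N); exact: cvg_inner.
Qed.

(** Schur product: factor the second Gram matrix and apply positivity of [A] to
    each column of the factor. *)
Lemma psd_schur (E J : hilbertType R) (I : countType) (W : seq I) (e : I -> E) n
    (A : 'I_n -> 'I_n -> bop E E) (y : 'I_n -> I -> J) : psd A ->
  0 <= \sum_i \sum_j \sum_(x <- W) \sum_(z <- W)
         inner (A i j (e z)) (e x) * inner (y j z) (y i x).
Proof.
move=> Apsd.
pose Y p : J := if unpickle p is Some (i, x) then y i x else 0.
pose code (i : 'I_n) (x : I) : nat := pickle (i, x).
have YE i x : Y (code i x) = y i x by rewrite /Y /code pickleK.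
have [a [_ aP]] := gram_factorization (gram_positive Y).
pose N := (\max_(i < n) \max_(x <- W) code i x).+1.
have NP i x : x \in W -> (code i x < N)%N.
  move=> xW; rewrite ltnS (bigD1 i)//= leq_max; apply/orP; left.
  exact: (leq_bigmax_seq x).
have -> : \sum_i \sum_j \sum_(x <- W) \sum_(z <- W)
         inner (A i j (e z)) (e x) * inner (y j z) (y i x) =
  \sum_(m < N) \sum_i \sum_j
     inner (A i j (\sum_(z <- W) a (code j z) m *: e z))
           (\sum_(x <- W) a (code i x) m *: e x).
  rewrite [RHS]exchange_big /=; apply: eq_bigr => i _.
  rewrite [RHS]exchange_big /=; apply: eq_bigr => j _.
  under [RHS]eq_bigr do rewrite inner_sumr.
  rewrite [RHS]exchange_big /=; apply: eq_bigr => x _.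
  under [RHS]eq_bigr do rewrite bopsum inner_suml.
  rewrite [RHS]exchange_big /= big_seq [RHS]big_seq; apply: eq_bigr => z zW.
  rewrite -!YE (aP _ _ N) ?NP// mulr_sumr; apply: eq_bigr => m _.
  by rewrite bopZ innerZl innerZr; ring.
by apply: sumr_ge0 => m _; exact: Apsd.
Qed.

End PositiveKernels.

(** * Row isometries, words and the free disk algebra *)

Section RowIsometries.
Variables (R : realType) (d : nat).
Local Notation C := R[i].

Section Family.
Variables (E : hilbertType R) (S : 'I_d -> bop E E).

(** Componentwise form of a [d]-isometry: the components are isometries with
    mutually orthogonal ranges. *)
Definition row_isometric : Prop :=
  forall i j x y, inner (S i x) (S j y) = (i == j)%:R * inner x y.

Definition word_op (alpha : seq 'I_d) : bop E E :=
  foldr (fun j T => bcomp (S j) T) (bid E) alpha.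

(** The operator [S w^*]; for the creation operators it is [Lstar]. *)
Definition row_dot (w : 'rV[C]_d) : bop E E := \sum_j (w 0 j)^* *: S j.

Lemma word_op_cat alpha beta :
  word_op (alpha ++ beta) = bcomp (word_op alpha) (word_op beta).
Proof. by elim: alpha => [|j alpha IH] /=; [|rewrite IH]; apply: bopE. Qed.

Lemma row_dotE w x : row_dot w x = \sum_j (w 0 j)^* *: S j x.
Proof. by rewrite /row_dot bopsumE; apply: eq_bigr. Qed.

Lemma word_op_algebra (A : set (bop E E)) alpha : unital_closed_algebra A ->
  (forall j, A (S j)) -> A (word_op alpha).
Proof. by move=> [_ _ A1 AM] AS; elim: alpha => //= j alpha IH; exact: AM. Qed.

Hypothesis Siso : row_isometric.

Lemma row_dot_inner (z w : 'rV[C]_d) x y :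
  inner (row_dot w x) (row_dot z y) = cdot z w * inner x y.
Proof.
rewrite !row_dotE inner_suml /cdot mulr_suml; apply: eq_bigr => i _.
rewrite inner_sumr (bigD1 i)//= big1 ?addr0 => [|j ji].
  by rewrite innerZl innerZr Siso eqxx mul1r conjCK; ring.
by rewrite innerZl innerZr Siso eq_sym (negbTE ji) mul0r !mulr0.
Qed.

Lemma row_dot_norm (w : @unit_ball R d) : `|row_dot (val w)| < 1.
Proof.
have w1 : cdot (val w) (val w) < 1.
  have := set_mem (valP w); rewrite /unit_ball /= /cdot.
  by under eq_bigr do rewrite normCK.
have w0 : 0 <= cdot (val w) (val w).
  by apply: sumr_ge0 => j _; rewrite -normCK exprn_ge0.
apply: (@le_lt_trans _ _ (sqrtC (cdot (val w) (val w)))).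
  apply: opnorm_le => [|x]; first by rewrite sqrtC_ge0.
  rewrite -(@ler_pXn2r _ 2%N)// ?nnegrE ?mulr_ge0 ?sqrtC_ge0//.
  by rewrite exprMn sqrtCK -!inner_norm row_dot_inner.
by rewrite -[ltRHS]sqrtC1 ltr_sqrtC ?qualifE /= ?ler01.
Qed.

(** Because [S_i^* S_j] is [0] or [I], a product of an adjoint resolvent and a
    resolvent is a multiple of the sum of the two minus the identity; here the
    identity is tested on vectors. *)
Lemma row_resolvent_inner (z w : 'rV[C]_d) (x y x0 y0 : E) :
  x - row_dot w x = x0 -> y - row_dot z y = y0 ->
  (1 - cdot z w) * inner x y = inner x y0 + inner x0 y - inner x0 y0.
Proof.
move=> <- <-; rewrite mulrBl mul1r -row_dot_inner !innerBr !innerBl; ring.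
Qed.

Lemma word_op_toeplitz i j alpha beta x y :
  inner (word_op (i :: alpha) x) (word_op (j :: beta) y) =
  (i == j)%:R * inner (word_op alpha x) (word_op beta y).
Proof. exact: Siso. Qed.

End Family.

Section RowOperator.
Variable J : hilbertType R.
Implicit Types i j k : 'I_d.

Lemma hsum_inner (x y : hsum d J) : inner x y = \sum_j inner (x j) (y j).
Proof. by []. Qed.

Lemma hsum_injE j (x : J) k : hsum_inj j x k = if k == j then x else 0.
Proof. by rewrite ffunE. Qed.

Lemma hsum_inj_linear j a (x y : J) :
  hsum_inj j (a *: x + y) = a *: hsum_inj j x + hsum_inj j y.
Proof.
apply/ffunP => k; rewrite !ffunE; case: eqP => // _.
by rewrite scaler0 addr0.
Qed.

Lemma hsum_sum_inj (x : hsum d J) : x = \sum_j hsum_inj j (x j).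
Proof.
apply/ffunP => k; rewrite sum_ffunE (bigD1 k)//= hsum_injE eqxx big1 ?addr0// => j jk.
by rewrite hsum_injE eq_sym (negbTE jk).
Qed.

Lemma hsum_inj_inner i j (x y : J) :
  inner (hsum_inj i x) (hsum_inj j y) = (i == j)%:R * inner x y.
Proof.
rewrite hsum_inner (bigD1 i)//= hsum_injE eqxx big1 ?addr0 => [|k ki].
  by rewrite hsum_injE; case: eqP => // _; rewrite ?mul1r ?mul0r ?inner0r.
by rewrite hsum_injE (negbTE ki) inner0l.
Qed.

Lemma hsum_inj_norm j (x : J) : `|hsum_inj j x| = `|x|.
Proof. by apply: norm_inner_eq; rewrite hsum_inj_inner eqxx mul1r. Qed.

Variable D : bop (hsum d J) J.

Lemma row_comp_subproof j : bounded_linear (fun x => D (hsum_inj j x)).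
Proof.
split=> [a x y|]; first by rewrite hsum_inj_linear bopD bopZ.
by exists `|D| => x; rewrite -(hsum_inj_norm j x) bop_norm_le.
Qed.

Definition row_comp j : bop J J := to_bop (row_comp_subproof j).

Lemma row_wordE alpha x : row_word D alpha x = word_op row_comp alpha x.
Proof. by elim: alpha => //= j alpha ->. Qed.

Lemma row_opE x : D x = \sum_j row_comp j (x j).
Proof. by rewrite {1}(hsum_sum_inj x) bopsum. Qed.

Lemma row_comp_isometric : isometric D -> row_isometric row_comp.
Proof.
by move=> Diso i j x y; rewrite /= (isometric_inner _ _ Diso) hsum_inj_inner.
Qed.

End RowOperator.

Lemma hsum_total (J : hilbertType R) (X : set J) : closed_span X = setT ->
  closed_span [set hsum_inj (d := d) j x | j in setT & x in X] = setT.
Proof.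
move=> Xt; rewrite -subTset => x _; rewrite (hsum_sum_inj x).
apply: (lin_sub_sum _ (closed_span_lin _)) => j _.
have : closed_span X (x j) by rewrite Xt.
move: (x j) => {x}y; move: y.
pose Y := closed_span [set hsum_inj (d := d) j x | j in setT & x in X].
apply: (closed_span_min (M := [set y | Y (hsum_inj j y)])).
- apply: closed_seq => u y Yu uy; have Yc : closed Y := @closed_span_closed _ _ _.
  apply: (@in_closed _ _ Y (fun n => hsum_inj j (u n)) _ Yc Yu).
  apply: (@cvg_lip _ _ _ (@hsum_inj R d J j) 1 _ _ _ uy) => a b.
  have -> : hsum_inj j a - hsum_inj j b = hsum_inj j (a - b).
    rewrite addrC -scaleN1r -hsum_inj_linear scaleN1r addrC //.
  by rewrite hsum_inj_norm mul1r.
- split=> [|a y z Yy Yz].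
    have -> : [set y | Y (hsum_inj j y)] 0 = Y (hsum_inj j 0) by [].
    have -> : hsum_inj j 0 = 0 :> hsum d J.
      by apply/ffunP => k; rewrite hsum_injE ffunE if_same.
    exact: (lin_sub0 (closed_span_lin _)).
  by rewrite /= hsum_inj_linear; exact: (closed_span_lin _).2.
- by move=> y Xy; apply: closed_span_sub; exists j => //; exists y.
Qed.

End RowIsometries.

Section AddAdjoint.
Variables (R : realType) (E : hilbertType R).
Local Notation C := R[i].
Implicit Types (X : set (bop E E)) (S T : bop E E).

Lemma add_adj_closed X : closed (add_adj X).
Proof. exact: closed_closure. Qed.

Lemma add_adj_lin X : lin_subspace X -> lin_subspace (add_adj X).
Proof.
move=> Xl; apply: closure_lin; split.
  exists 0; first exact: lin_sub0.
  by exists 0; [exact: lin_sub0|rewrite adj0 addr0].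
move=> a _ _ [S XS [T XT <-]] [S' XS' [T' XT' <-]].
exists (a *: S + S'); first exact: Xl.2.
exists (a^* *: T + T'); first exact: Xl.2.
by rewrite adj_linear conjCK scalerDr addrACA.
Qed.

Lemma add_adj_sub X : lin_subspace X -> X `<=` add_adj X.
Proof.
move=> Xl S XS; apply: subset_closure; exists S => //.
by exists 0; [exact: lin_sub0|rewrite adj0 addr0].
Qed.

Lemma add_adj_adj_sub X S : lin_subspace X -> X S -> add_adj X (adj S).
Proof.
move=> Xl XS; apply: subset_closure; exists 0; first exact: lin_sub0.
by exists S; rewrite ?add0r.
Qed.

Lemma add_adj_adj X S : add_adj X S -> add_adj X (adj S).
Proof.
move=> /closure_seq[u [Xu uS]].
apply: (in_closed (@add_adj_closed X) _ (cvg_adj uS)) => n; apply: subset_closure.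
have [A XA [B XB <-]] := Xu n; exists B => //; exists A => //.
by rewrite adjD adjK addrC.
Qed.

Lemma add_adj_min X M : closed M -> lin_subspace M ->
  (forall S, M S -> M (adj S)) -> X `<=` M -> add_adj X `<=` M.
Proof.
move=> cM lM aM XM S /closure_seq[u [Xu uS]]; apply: in_closed cM _ uS => n.
by have [A XA [B XB <-]] := Xu n; apply: lin_subD => //; [|apply: aM]; exact: XM.
Qed.

End AddAdjoint.

Section FreeDiskAlgebra.
Variables (R : realType) (d : nat) (F : full_fock R d).
Local Notation C := R[i].
Local Notation L := (creation F).

(** The relation is clear on basis vectors and passes to closed spans in each
    variable separately. *)
Lemma creation_row_isometric : row_isometric L.
Proof.
move=> i j x y.
have tot z : closed_span (range (fock_basis F)) z by rewrite fock_total.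
have basis alpha y' : inner (L i (fock_basis F alpha)) (L j y') =
    (i == j)%:R * inner (fock_basis F alpha) y'.
  move: y' (tot y'); apply: (closed_span_min (M := [set y' | _ = _])).
  - apply: closed_seq => u z uz cu.
    apply: cvgC_unique (cvg_inner (cvg_cst (L i (fock_basis F alpha))) (cvg_bop (T := L j) cu)) _.
    under eq_fun do rewrite uz.
    exact: (cvgZl_tmp (V := C^o) (k := (i == j)%:R)
      (cvg_inner (cvg_cst (fock_basis F alpha)) cu)).
  - split=> [|a u v /= hu hv]; first by rewrite /= bop0 !inner0r mulr0.
    by rewrite /= bopD bopZ !innerDr !innerZr hu hv; ring.
  - move=> _ [beta _ <-] /=; rewrite !creationE !fock_orthonormal eqseq_cons.
    by case: eqP; rewrite ?mul1r ?mul0r.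
move: x (tot x); apply: (closed_span_min (M := [set x | _ = _])).
- apply: closed_seq => u z uz cu.
  apply: cvgC_unique (cvg_inner (cvg_bop (T := L i) cu) (cvg_cst (L j y))) _.
  under eq_fun do rewrite uz.
  exact: (cvgZl_tmp (V := C^o) (k := (i == j)%:R) (cvg_inner cu (cvg_cst y))).
- split=> [|a u v /= hu hv]; first by rewrite /= bop0 !inner0l mulr0.
  by rewrite /= bopD bopZ !innerDl !innerZl hu hv; ring.
- by move=> _ [alpha _ <-] /=.
Qed.

Lemma word_op_fock alpha beta :
  word_op L alpha (fock_basis F beta) = fock_basis F (alpha ++ beta).
Proof. by elim: alpha => //= j alpha ->; exact: creationE. Qed.

Lemma free_disk_algebra_closed : unital_closed_algebra (free_disk_algebra F).
Proof.
split.
- apply: closed_seq => u x Au ux M MA; have /= [[cM _ _ _] _] := MA.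
  by apply: (in_closed cM _ ux) => n; exact: Au n M MA.
- split=> [|a x y Ax Ay] M MA; have /= [[_ lM _ _] _] := MA; first exact: lM.1.
  by apply: lM.2; [exact: Ax M MA|exact: Ay M MA].
- by move=> M /= [[]].
- move=> S T AS AT M MA; have /= [[_ _ _ MM] _] := MA.
  by apply: MM; [exact: AS M MA|exact: AT M MA].
Qed.

Lemma free_disk_creation j : free_disk_algebra F (L j).
Proof. by move=> M /= [_]; apply; exists j. Qed.

Lemma free_disk_lin : lin_subspace (free_disk_algebra F).
Proof. by case: free_disk_algebra_closed. Qed.

(** A closed span of words is already an algebra, since multiplication is
    continuous in each factor and words are closed under concatenation. *)
Lemma free_disk_algebra_words :
  free_disk_algebra F = closed_span (range (word_op L)).
Proof.
pose W := closed_span (range (word_op L)).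
have Wl : lin_subspace W := closed_span_lin _.
have Wc : closed W := @closed_span_closed _ _ _.
apply/seteqP; split.
  apply: smallest_sub; last first.
    by move=> _ [j _ <-]; apply: closed_span_sub; exists [:: j] => //=; apply: bopE.
  split=> //; first by apply: closed_span_sub; exists [::].
  have W1 alpha T : W T -> W (bcomp (word_op L alpha) T).
    move: T; apply: (closed_span_min (M := [set T | W (bcomp (word_op L alpha) T)])).
    - by apply: closed_seq => u T Wu uT; apply: (in_closed Wc Wu (cvg_bcompr uT)).
    - split=> [|a S T WS WT].
        rewrite /=; have -> : bcomp (word_op L alpha) (0 : bop F F) = 0.
          by apply: bopE => x; exact: bop0.
        exact: lin_sub0.
      rewrite /=; have -> : bcomp (word_op L alpha) (a *: S + T) =
        a *: bcomp (word_op L alpha) S + bcomp (word_op L alpha) T.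
        by apply: bopE => x; rewrite /= bopD bopZ.
      exact: Wl.2.
    - move=> _ [beta _ <-] /=; apply: closed_span_sub; exists (alpha ++ beta) => //.
      exact: word_op_cat.
  move=> S T WS WT; move: S WS.
  apply: (closed_span_min (M := [set S | W (bcomp S T)])).
  - by apply: closed_seq => u S Wu uS; apply: (in_closed Wc Wu (cvg_bcompl uS)).
  - split=> [|a S S' WS WS'].
      rewrite /=; have -> : bcomp (0 : bop F F) T = 0 by apply: bopE.
      exact: lin_sub0.
    rewrite /=; have -> : bcomp (a *: S + S') T = a *: bcomp S T + bcomp S' T.
      by apply: bopE.
    exact: Wl.2.
  - by move=> _ [alpha _ <-] /=; exact: W1.
apply: closed_span_min.
- by case: free_disk_algebra_closed.
- exact: free_disk_lin.
- move=> _ [alpha _ <-]; apply: word_op_algebra free_disk_algebra_closed _.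
  exact: free_disk_creation.
Qed.

Lemma free_disk_word alpha : free_disk_algebra F (word_op L alpha).
Proof. by rewrite free_disk_algebra_words; apply: closed_span_sub; exists alpha. Qed.

Lemma free_disk_resolvent (w : @unit_ball R d) :
  free_disk_algebra F (opinv (bid F - Lstar F (val w))).
Proof.
apply: closed_algebra_resolvent free_disk_algebra_closed _ _.
  rewrite /Lstar; apply: (lin_sub_sum _ free_disk_lin) => j _.
  by apply: (lin_subZ _ free_disk_lin); exact: free_disk_creation.
exact: (row_dot_norm creation_row_isometric).
Qed.

Lemma toeplitz_cons i j alpha beta :
  bcomp (adj (word_op L (i :: alpha))) (word_op L (j :: beta)) =
  (i == j)%:R *: bcomp (adj (word_op L alpha)) (word_op L beta).
Proof.
apply: bopE => x; apply: inner_inj => y; rewrite bopZE innerZl.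
transitivity (inner (word_op L (j :: beta) x) (word_op L (i :: alpha) y)).
  exact: (esym (adjPr _ _ _)).
rewrite (word_op_toeplitz creation_row_isometric) eq_sym; congr (_ * _).
exact: adjPr.
Qed.

Lemma toeplitz_diag alpha :
  bcomp (adj (word_op L alpha)) (word_op L alpha) = bid F.
Proof.
elim: alpha => [|i alpha IH]; last by rewrite toeplitz_cons eqxx scale1r.
by apply: bopE => x /=; rewrite adj_id.
Qed.

(** Since [L_i^* L_j] is [0] or [I], cancelling first letters leaves a word or the
    adjoint of a word. *)
Lemma free_disk_toeplitz alpha beta :
  add_adj (free_disk_algebra F) (bcomp (adj (word_op L alpha)) (word_op L beta)).
Proof.
elim: alpha beta => [|i alpha IH] beta.
  have -> : bcomp (adj (word_op L [::])) (word_op L beta) = word_op L beta.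
    by apply: bopE => x /=; rewrite adj_id.
  exact: add_adj_sub free_disk_lin _ (free_disk_word _).
case: beta => [|j beta].
  have -> : bcomp (adj (word_op L (i :: alpha))) (word_op L [::]) =
    adj (word_op L (i :: alpha)) by apply: bopE.
  exact: add_adj_adj_sub free_disk_lin (free_disk_word _).
by rewrite toeplitz_cons; exact: (lin_subZ _ (add_adj_lin free_disk_lin)).
Qed.

End FreeDiskAlgebra.

(** * Completely positive maps on operator systems *)

Section CompletePositivity.
Variables (R : realType) (E H : hilbertType R).
Local Notation C := R[i].
Implicit Types (Y : set (bop E E)) (S T : bop E E).

Definition operator_system Y : Prop :=
  [/\ closed Y, lin_subspace Y, forall T, Y T -> Y (adj T) & Y (bid E)].

(** Complete positivity of a map defined on all operators but only considered on
    [Y]; this spares the membership proofs carried by a map of domain [Y]. *)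
Definition cp_on Y (f : bop E E -> bop H H) : Prop :=
  (forall a S T, Y S -> Y T -> f (a *: S + T) = a *: f S + f T) /\
  (forall n (A : 'I_n -> 'I_n -> bop E E), (forall i j, Y (A i j)) -> psd A ->
     psd (fun i j => f (A i j))).

Definition total_ext Y (phi : Y -> bop H H) (T : bop E E) : bop H H :=
  if pselect (Y T) is left YT then phi (exist _ T (mem_set YT)) else 0.

Lemma total_extE Y (phi : Y -> bop H H) (x : Y) : total_ext phi (val x) = phi x.
Proof.
rewrite /total_ext; case: pselect => [YT|]; last by case; exact: set_mem (valP x).
by congr phi; apply: val_inj.
Qed.

Lemma total_extP Y (phi : Y -> bop H H) T (YT : Y T) :
  total_ext phi T = phi (exist _ T (mem_set YT)).
Proof. exact: (total_extE phi (exist _ T (mem_set YT))). Qed.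

Lemma total_ext_cp Y (phi : Y -> bop H H) : lin_subspace Y ->
  completely_positive phi -> cp_on Y (total_ext phi).
Proof.
move=> Yl [philin phipos]; split=> [a S T YS YT|n A YA Apsd].
  have YU := Yl.2 a _ _ YS YT.
  rewrite (total_extP phi YU) (total_extP phi YS) (total_extP phi YT).
  exact: philin.
pose B i j : Y := exist (fun T => T \in Y) (A i j) (mem_set (YA i j)).
have -> : (fun i j => total_ext phi (A i j)) = fun i j => phi (B i j).
  by apply/funext => i; apply/funext => j; exact: total_extP.
exact: phipos.
Qed.

Lemma cp_restrict Y (f : bop E E -> bop H H) : cp_on Y f ->
  completely_positive (fun x : Y => f (val x)).
Proof.
move=> [flin fpos]; split=> [a S T U ->|n A Apsd].
  by apply: flin; exact: set_mem (valP _).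
by apply: (fpos n (fun i j => val (A i j))) => // i j; exact: set_mem (valP _).
Qed.

Lemma Re_le_norm2 (z : C) : - (z + z^*) <= 2 * `|z|.
Proof.
have -> : - (z + z^*) = 2 * 'Re (- z) :> C.
  by rewrite ReE mulrC divfK ?pnatr_eq0// rmorphN opprD.
by rewrite ler_pM2l// -(normrN z); exact: (leif_Re_Creal (- z)).
Qed.

(** The shape in which two sesquilinear forms [g], [h] appear when one of their
    arguments is multiplied by [i]. *)
Lemma conj_of_real_sums (g h : C) : (g + h)^* = g + h ->
  ('i * g + 'i^* * h)^* = 'i * g + 'i^* * h -> g^* = h.
Proof.
rewrite !rmorphD !rmorphM /= conjCK conjCi => h1 h2.
apply: (@mulfI _ (2 * 'i)); first by rewrite mulf_neq0 ?neq0Ci ?pnatr_eq0.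
have -> : 2 * 'i * g^* = 'i * (g^* + h^*) - (- 'i * g^* + 'i * h^*) by ring.
by rewrite h1 h2; ring.
Qed.

(** Positivity of this matrix amounts to [`|T| <= t]; in this way complete
    positivity controls norms. *)
Definition norm_matrix (t : C) T (i j : 'I_2) : bop E E :=
  if i == j then t *: bid E else if i == ord0 then T else adj T.

Lemma norm_matrix_sum (K : hilbertType R) (f : bop E E -> bop K K) t T
    (x : 'I_2 -> K) :
  \sum_i \sum_j inner (f (norm_matrix t T i j) (x j)) (x i) =
  inner (f (t *: bid E) (x 0)) (x 0) + inner (f T (x 1)) (x 0) +
  (inner (f (adj T) (x 0)) (x 1) + inner (f (t *: bid E) (x 1)) (x 1)).
Proof.
rewrite !big_ord_recl !big_ord0 !addr0 /norm_matrix /=.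
by have -> : lift ord0 ord0 = 1 :> 'I_2 by apply: val_inj.
Qed.

Lemma norm_matrix_psd t T : `|T| <= t -> psd (norm_matrix t T).
Proof.
move=> Tt x; have := norm_matrix_sum id t T x; rewrite /= => ->.
rewrite ?bopZE !innerZl /= -adjPr [inner (x 0) (T _)]innerC.
set g := inner (T _) _; rewrite !inner_norm.
have gle : `|g| <= t * (`|x 0| * `|x 1|).
  rewrite (le_trans (inner_le_norm _ _))// mulrC mulrCA ler_wpM2l//.
  by rewrite (le_trans (bop_norm_le _ _))// ler_wpM2r.
have t0 : 0 <= t := le_trans (normr_ge0 _) Tt.
have -> : t * `|x 0| ^+ 2 + g + (g^* + t * `|x 1| ^+ 2) =
  t * (`|x 0| ^+ 2 + `|x 1| ^+ 2) - - (g + g^*) by ring.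
rewrite subr_ge0 (le_trans (Re_le_norm2 _))//.
apply: (@le_trans _ _ (2 * (t * (`|x 0| * `|x 1|)))); first by rewrite ler_pM2l.
rewrite mulrCA ler_wpM2l// -subr_ge0.
have -> : `|x 0| ^+ 2 + `|x 1| ^+ 2 - 2 * (`|x 0| * `|x 1|) = (`|x 0| - `|x 1|) ^+ 2.
  by ring.
by rewrite real_exprn_even_ge0// rpredB// ger0_real.
Qed.

Section Bounds.
Variables (Y : set (bop E E)) (f : bop E E -> bop H H).
Hypotheses (Ys : operator_system Y) (fcp : cp_on Y f).

Let Yl : lin_subspace Y. Proof. by case: Ys. Qed.
Let Y1 : Y (bid E). Proof. by case: Ys. Qed.
Let Ya T : Y T -> Y (adj T). Proof. by case: Ys => _ _ + _; exact. Qed.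

Lemma cp0 : f 0 = 0.
Proof.
have := fcp.1 (-1) _ _ (lin_sub0 Yl) (lin_sub0 Yl).
by rewrite scaler0 addr0 scaleN1r addNr.
Qed.

Lemma cpD S T : Y S -> Y T -> f (S + T) = f S + f T.
Proof. by move=> YS YT; have := fcp.1 1 _ _ YS YT; rewrite !scale1r. Qed.

Lemma cpZ a T : Y T -> f (a *: T) = a *: f T.
Proof. by move=> YT; have := fcp.1 a _ _ YT (lin_sub0 Yl); rewrite cp0 !addr0. Qed.

Lemma cpB S T : Y S -> Y T -> f (S - T) = f S - f T.
Proof.
move=> YS YT; rewrite -scaleN1r cpD//; last exact: (lin_subZ _ Yl).
by rewrite cpZ// scaleN1r.
Qed.

Lemma cp1_ge0 x : 0 <= inner (f (bid E) x) x.
Proof.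
have [_ /(_ 1%N (fun _ _ => bid E) (fun _ _ => Y1))] := fcp.
move=> /(_ _ (fun _ => x)); rewrite !big_ord1; apply.
by move=> z; rewrite !big_ord1 /= inner_ge0.
Qed.

Let pos2 t T x0 x1 : Y T -> `|T| <= t ->
  0 <= t * inner (f (bid E) x0) x0 + inner (f T x1) x0 +
       (inner (f (adj T) x0) x1 + t * inner (f (bid E) x1) x1).
Proof.
move=> YT Tt; have YA i j : Y (norm_matrix t T i j).
  rewrite /norm_matrix; case: ifP => _; first exact: (lin_subZ _ Yl).
  by case: ifP => _ //; exact: Ya.
have [_ /(_ _ _ YA (norm_matrix_psd Tt) (fun i => if i == 0 then x0 else x1))] := fcp.
by rewrite norm_matrix_sum /= cpZ// !bopZE !innerZl.
Qed.

(** Positivity of the matrix with entries [t], [T] and [T^*] forces the two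
    off-diagonal terms to have a real sum; replacing a vector by its multiple by
    [i] shows that these are conjugate. *)
Lemma cp_adj T : Y T -> f (adj T) = adj (f T).
Proof.
move=> YT; apply: bopE => x; apply: inner_inj => y; rewrite -adjPr.
have real_sum x0 x1 : (inner (f T x1) x0 + inner (f (adj T) x0) x1)^* =
    inner (f T x1) x0 + inner (f (adj T) x0) x1.
  apply/CrealP; have := pos2 x0 x1 YT (lexx _).
  set a := `|T| * inner (f (bid E) x0) x0; set b := `|T| * inner _ _.
  move=> h; have -> : inner (f T x1) x0 + inner (f (adj T) x0) x1 =
    (a + inner (f T x1) x0 + (inner (f (adj T) x0) x1 + b)) - a - b by ring.
  by rewrite !rpredB ?ger0_real// mulr_ge0// cp1_ge0.
have h1 := real_sum x y; have := real_sum x ('i *: y).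
by rewrite bopZ innerZl innerZr => /(conj_of_real_sums h1) <-; rewrite -innerC.
Qed.

(** Multiplying one vector by a phase turns the positivity of the matrix with
    entries [t], [T], [T^*] into an inequality for the modulus of the
    off-diagonal term. *)
Lemma cp_norm c T : 0 <= c ->
  (forall x, inner (f (bid E) x) x <= c * `|x| ^+ 2) -> Y T -> `|f T| <= c * `|T|.
Proof.
move=> c0 fc YT.
have unit_bound x y : `|x| = 1 -> `|y| = 1 -> `|inner (f T x) y| <= c * `|T|.
  move=> x1 y1; set g := inner _ _.
  have [->|g0] := eqVneq g 0; first by rewrite normr0 mulr_ge0.
  (* The phase for which the off-diagonal terms become [- `|g|]. *)
  pose u : C := - (g^* / `|g|).
  have := pos2 y (u *: x) YT (lexx _).
  rewrite cp_adj// -adjPr bopZ innerZl [inner y _]innerC innerZl -/g.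
  have ug : u * g = - `|g|.
    by rewrite /u mulNr mulrAC [_^* * _]mulrC -normCK expr2 mulfK// normr_eq0.
  rewrite ug rmorphN /= (CrealP (normr_real g)) => h.
  have u1 : `|u| = 1.
    by rewrite /u normrN normrM norm_conjC normfV normr_id mulfV// normr_eq0.
  have hy := fc y; have hx := fc (u *: x).
  rewrite y1 expr1n mulr1 in hy; rewrite normrZ u1 mul1r x1 expr1n mulr1 in hx.
  have hy' := ler_wpM2l (normr_ge0 T) hy; have hx' := ler_wpM2l (normr_ge0 T) hx.
  rewrite -(ler_pM2l (ltr0n C 2)) -subr_ge0.
  apply: (le_trans h); rewrite -subr_ge0.
  set a := `|T| * inner (f _ y) y in hy' *; set b := `|T| * inner _ _ in hx' *.
  have -> : 2 * (c * `|T|) - 2 * `|g| - (a + - `|g| + (- `|g| + b)) =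
    (`|T| * c - a) + (`|T| * c - b) by ring.
  by rewrite addr_ge0// subr_ge0.
apply: opnorm_inner => [|x y]; first by rewrite mulr_ge0.
have [->|x0] := eqVneq x 0; first by rewrite bop0 inner0l !normr0 mulr0 mul0r.
have [->|y0] := eqVneq y 0; first by rewrite inner0r !normr0 mulr0.
have xn : 0 < `|x| by rewrite normr_gt0.
have yn : 0 < `|y| by rewrite normr_gt0.
have := unit_bound (`|x|^-1 *: x) (`|y|^-1 *: y).
rewrite !normrZ !normfV !normr_id !mulVf ?gt_eqF// bopZ innerZl innerZr.
rewrite !normrM norm_conjC !normfV !normr_id => /(_ erefl erefl).
by rewrite mulrA -invfM mulrC ler_pdivrMr ?mulr_gt0// mulrA.
Qed.

Lemma cp_bounded T : Y T -> `|f T| <= `|f (bid E)| * `|T|.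
Proof.
apply: cp_norm => // x.
rewrite -[leLHS]ger0_norm ?cp1_ge0// (le_trans (inner_le_norm _ _))//.
by rewrite expr2 mulrA ler_wpM2r// bop_norm_le.
Qed.

Lemma cp_cvg (u : nat -> bop E E) (T : bop E E) : (forall n, Y (u n)) -> Y T ->
  u @ \oo --> T -> (fun n => f (u n)) @ \oo --> f T.
Proof.
move=> Yu YT uT; apply: cvg_distP => e e0.
have [N Ne] := cvg_dist uT (divr_gt0 e0 (ltr_pwDr ltr01 (normr_ge0 (f (bid E))))).
exists N => n /Ne; rewrite ltr_pdivlMr ?ltr_pwDr//; apply: le_lt_trans.
rewrite -cpB// (le_trans (cp_bounded _))//; first exact: lin_subB.
by rewrite mulrC ler_wpM2l// lerDl.
Qed.

End Bounds.

(** Completely positive maps are continuous and commute with adjoints, so that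
    they are determined by their values on a set of generators. *)
Lemma cp_on_eq (X Y Z : set (bop E E)) (f g : bop E E -> bop H H) :
  operator_system Y -> operator_system Z -> cp_on Y f -> cp_on Z g ->
  (forall T, X T -> [/\ Y T, Z T & f T = g T]) ->
  forall T, add_adj (closed_span X) T -> [/\ Y T, Z T & f T = g T].
Proof.
move=> Ys Zs fcp gcp fg; have [Yc Yl Ya _] := Ys; have [Zc Zl Za _] := Zs.
pose M := [set T | [/\ Y T, Z T & f T = g T]].
have Mc : closed M.
  apply: closed_seq => u T Mu uT.
  have Yu n : Y (u n) by case: (Mu n).
  have Zu n : Z (u n) by case: (Mu n).
  have YT := in_closed Yc Yu uT; have ZT := in_closed Zc Zu uT; split=> //.
  apply: cvgV_unique (cp_cvg Ys fcp Yu YT uT) _.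
  have -> : (fun n => f (u n)) = fun n => g (u n).
    by apply/funext => n; case: (Mu n).
  exact: (cp_cvg Zs gcp Zu ZT uT).
have Ml : lin_subspace M.
  split=> [|a S T [YS ZS fgS] [YT ZT fgT]].
    by split; [exact: lin_sub0|exact: lin_sub0|rewrite (cp0 Ys fcp) (cp0 Zs gcp)].
  split; [exact: Yl.2|exact: Zl.2|].
  by rewrite fcp.1// gcp.1// fgS fgT.
apply: (add_adj_min (M := M)) => //.
  move=> S [YS ZS fgS]; split; [exact: Ya|exact: Za|].
  by rewrite (cp_adj Ys fcp)// (cp_adj Zs gcp)// fgS.
exact: closed_span_min.
Qed.

End CompletePositivity.

Section OperatorSystems.
Variables (R : realType) (d : nat) (F : full_fock R d).

Lemma add_adj_operator_system (E : hilbertType R) (X : set (bop E E)) :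
  lin_subspace X -> X (bid E) -> operator_system (add_adj X).
Proof.
move=> Xl X1; split; [exact: add_adj_closed|exact: add_adj_lin| |].
- by move=> T; exact: add_adj_adj.
- exact: add_adj_sub.
Qed.

Lemma free_disk_system : operator_system (add_adj (free_disk_algebra F)).
Proof.
apply: add_adj_operator_system; first exact: free_disk_lin.
by case: (free_disk_algebra_closed F).
Qed.

Lemma resolvent0 : opinv (bid F - Lstar F 0) = bid F.
Proof.
have -> : Lstar F 0 = 0.
  by rewrite /Lstar big1// => j _; rewrite mxE rmorph0 scale0r.
by rewrite subr0; apply: opinv_uniq; apply: bopE.
Qed.

Lemma szego_system : operator_system (add_adj (szego_span F)).
Proof.
apply: add_adj_operator_system; first exact: closed_span_lin.
apply: closed_span_sub; exists 0; last exact: resolvent0.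
exact: set_mem (unit_ball0 R d).
Qed.

Lemma szego_span_resolvent (w : @unit_ball R d) :
  szego_span F (opinv (bid F - Lstar F (val w))).
Proof. by apply: closed_span_sub; exists (val w) => //; exact: set_mem (valP w). Qed.

Variables (J H : hilbertType R) (S : 'I_d -> bop J J) (W : bop H J).
Hypothesis Siso : row_isometric S.
Variable f : bop F F -> bop H H.
Hypothesis fcp : cp_on (add_adj (free_disk_algebra F)) f.
Local Notation L := (creation F).
Local Notation A := (add_adj (free_disk_algebra F)).
Hypothesis fS : forall alpha x y,
  inner (f (word_op L alpha) x) y = inner (word_op S alpha (W x)) (W y).

(** The moments of [f] determine its values on the powers of [Lw^*], hence, by
    the Neumann series, on the resolvents. *)
Lemma cp_resolvent (w : @unit_ball R d) x y :
  inner (f (opinv (bid F - Lstar F (val w))) x) y =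
  inner (opinv (bid J - row_dot S (val w)) (W x)) (W y).
Proof.
pose rel T (S' : bop J J) := A T /\ forall x y, inner (f T x) y = inner (S' (W x)) (W y) :> R[i].
have [Ac Al _ _] := free_disk_system.
have rel_sum I (r : seq I) (c : I -> R[i]) T S' : (forall i, rel (T i) (S' i)) ->
    rel (\sum_(i <- r) c i *: T i) (\sum_(i <- r) c i *: S' i).
  move=> TS; apply: big_ind2 => [|T1 S1 T2 S2 [A1 r1] [A2 r2]|i _].
  - split=> [|x' y']; first exact: (lin_sub0 Al).
    by rewrite (cp0 free_disk_system fcp) !inner0l.
  - split=> [|x' y']; first exact: (lin_subD Al).
    by rewrite (cpD fcp)// !bopDE !innerDl r1 r2.
  - have [Ai ri] := TS i; split=> [|x' y']; first exact: (lin_subZ _ Al).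
    by rewrite (cpZ free_disk_system fcp)// !bopZE !innerZl ri.
have rel_pow k alpha : rel (bcomp (word_op L alpha) (bpow (Lstar F (val w)) k))
    (bcomp (word_op S alpha) (bpow (row_dot S (val w)) k)).
  elim: k alpha => [|k IH] alpha.
    have -> : bcomp (word_op L alpha) (bpow (Lstar F (val w)) 0) = word_op L alpha.
      by apply: bopE.
    split; last exact: fS.
    apply: (add_adj_sub (free_disk_lin F)). exact: free_disk_word.
  have -> : bcomp (word_op L alpha) (bpow (Lstar F (val w)) k.+1) =
      \sum_j (val w 0 j)^* *: bcomp (word_op L (rcons alpha j)) (bpow (Lstar F (val w)) k).
    apply: bopE => z; rewrite bopsumE -[RHS]/(\sum_j _) /= -/(bpow _ k).
    rewrite -[Lstar F (val w)]/(row_dot L (val w)) row_dotE bopsum; apply: eq_bigr => j _.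
    by rewrite bopZ -cats1 word_op_cat.
  have -> : bcomp (word_op S alpha) (bpow (row_dot S (val w)) k.+1) =
      \sum_j (val w 0 j)^* *: bcomp (word_op S (rcons alpha j)) (bpow (row_dot S (val w)) k).
    apply: bopE => z; rewrite bopsumE -[RHS]/(\sum_j _) /= -/(bpow _ k).
    rewrite row_dotE bopsum; apply: eq_bigr => j _.
    by rewrite bopZ -cats1 word_op_cat.
  by apply: rel_sum => j; exact: IH.
have [_ _ cL] := neumann (row_dot_norm (creation_row_isometric (F := F)) w).
have [_ _ cS] := neumann (row_dot_norm Siso w).
have AL : A (opinv (bid F - row_dot L (val w))).
  by apply: (add_adj_sub (free_disk_lin F)); exact: free_disk_resolvent.
have relN N : rel (\sum_(k < N) bpow (row_dot L (val w)) k)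
    (\sum_(k < N) bpow (row_dot S (val w)) k).
  have := rel_sum _ (index_enum 'I_N) (fun _ => 1) _ _ (fun k => rel_pow k [::]).
  under eq_bigr do rewrite scale1r; under [X in rel _ X -> _]eq_bigr do rewrite scale1r.
  congr (rel _ _); apply: eq_bigr => k _; exact: bopE.
have cf := cp_cvg free_disk_system fcp (fun N => (relN N).1) AL cL.
rewrite -[Lstar F _]/(row_dot L (val w)).
apply: (cvgC_unique (cvg_inner (cvg_bop_app (x := x) cf) (cvg_cst y))).
under eq_fun => N do rewrite (relN N).2.
exact: cvg_inner (cvg_bop_app (x := W x) cS) (cvg_cst (W y)).
Qed.

End OperatorSystems.

(** * Closed subspaces as Hilbert spaces *)

Section ClosedSubspaceType.
Variables (R : realType) (E : hilbertType R).
Local Notation C := R[i].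

Record closed_subspace := ClosedSubspace {
  cs_set :> set E;
  cs_closed : closed cs_set;
  cs_lin : lin_subspace cs_set }.

Variable M : closed_subspace.

Definition cs_pred : {pred E} := fun x => `[< cs_set M x >].

Record cs_type := CsType { cs_val :> E; _ : cs_val \in cs_pred }.

HB.instance Definition _ := [isSub for cs_val].
HB.instance Definition _ := [Choice of cs_type by <:].

Lemma cs_submod_closed : submod_closed cs_pred.
Proof.
split=> [|a x y]; rewrite !unfold_in; first exact/asboolP/(lin_sub0 (cs_lin M)).
by move=> /asboolP Mx /asboolP My; apply/asboolP; exact: (cs_lin M).2.
Qed.
HB.instance Definition _ := GRing.isSubmodClosed.Build _ _ cs_pred
  cs_submod_closed.
HB.instance Definition _ := [SubChoice_isSubLmodule of cs_type by <:].

Lemma cs_valP (x : cs_type) : cs_set M (cs_val x).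
Proof. by case: x => x /= /asboolP. Qed.

Definition to_cs (x : E) (Mx : cs_set M x) : cs_type := CsType (introT (asboolP _) Mx).

Definition cs_dot (x y : cs_type) : C := inner (cs_val x) (cs_val y).

Lemma cs_dot_is_bilinear :
  bilinear_for *%R (@Num.conj C \; *%R) cs_dot.
Proof.
by split=> [y|x] a u v; rewrite /cs_dot /= ?innerDl ?innerZl ?innerDr ?innerZr.
Qed.
HB.instance Definition _ :=
  bilinear_isBilinear.Build _ _ _ _ _ _ cs_dot cs_dot_is_bilinear.

Lemma cs_dot_hermitian (x y : cs_type) :
  cs_dot x y = (-1) ^+ false * Num.conj (cs_dot y x).
Proof. by rewrite mul1r; exact: innerC. Qed.
HB.instance Definition _ :=
  isHermitianSesquilinear.Build _ _ false (@Num.conj C) cs_dot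
    cs_dot_hermitian.

Lemma cs_dot_gt0 (x : cs_type) : x != 0 -> 0 < cs_dot x x.
Proof.
move=> x0; rewrite /cs_dot dnorm_gt0; apply: contra x0 => /eqP x0.
by apply/eqP; apply: val_inj.
Qed.
HB.instance Definition _ := isDotProduct.Build _ _ cs_dot cs_dot_gt0.

Definition cs_norm (x : cs_type) : C := `|cs_val x|.

Lemma cs_normD x y : cs_norm (x + y) <= cs_norm x + cs_norm y.
Proof. exact: ler_normD. Qed.

Lemma cs_normZ (a : C) x : cs_norm (a *: x) = `|a| * cs_norm x.
Proof. exact: normrZ. Qed.

Lemma cs_norm_eq0 x : cs_norm x = 0 -> x = 0.
Proof. by move=> /eqP; rewrite normr_eq0 => /eqP x0; apply: val_inj. Qed.

HB.instance Definition _ := Lmodule_isNormed.Build C cs_type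
  cs_normD cs_normZ cs_norm_eq0.

Lemma cs_complete (G : set_system cs_type) :
  ProperFilter G -> cauchy G -> cvg G.
Proof.
move=> GG /cauchyP Gc.
have cvgG : cvg (cs_val @ G).
  apply/cauchy_cvgP/cauchy_exP => e e0; have [x Gx] := Gc e e0.
  exists (cs_val x); rewrite /fmap /=.
  by apply: (@filterS _ G _ (ball x e)) Gx => y; rewrite -!ball_normE.
have Ml : cs_set M (lim (cs_val @ G)).
  by apply: (closed_cvg _ (@cs_closed M) (nearW _ cs_valP) _ cvgG).
apply/cvg_ex; exists (to_cs Ml); apply/cvgrPdist_lt => e e0.
by have /cvgrPdist_lt/(_ _ e0) := cvgG.
Qed.

HB.instance Definition _ := Uniform_isComplete.Build cs_type cs_complete.

Lemma cs_inner_norm (x : cs_type) : cs_dot x x = `|x| ^+ 2.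
Proof. exact: inner_norm. Qed.

HB.instance Definition _ :=
  CompleteNormedModule_isHilbert.Build R cs_type cs_inner_norm.

Lemma cs_innerE (x y : cs_type) : inner x y = inner (cs_val x) (cs_val y).
Proof. by []. Qed.

Lemma cs_normE (x : cs_type) : `|x| = `|cs_val x|.
Proof. by []. Qed.

(** The subspace topology is the restriction of the norm, and [M] is closed, so
    closed spans may be computed in [E] or in [M]. *)
Lemma cs_total (I : Type) (v : I -> cs_type) :
  closed_span (range (fun i => cs_val (v i))) = cs_set M ->
  closed_span (range v) = setT.
Proof.
move=> vM; rewrite -subTset => x _.
have : closed_span (range (fun i => cs_val (v i))) (cs_val x).
  by rewrite vM; exact: cs_valP.
pose N := [set y | exists2 z : cs_type, cs_val z = y & closed_span (range v) z].
suff : closed_span (range (fun i => cs_val (v i))) `<=` N.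
  by move=> /[apply] -[z /val_inj ->].
apply: closed_span_min.
- apply: closed_seq => u y Nu uy.
  have /choice[w wP] n : exists z : cs_type, cs_val z = u n /\ closed_span (range v) z.
    by have [z zu vz] := Nu n; exists z.
  have wu n : cs_val (w n) = u n by case: (wP n).
  have vw n : closed_span (range v) (w n) by case: (wP n).
  have My : cs_set M y by apply: (in_closed (@cs_closed M) _ uy) => n; rewrite -wu; exact: cs_valP.
  exists (to_cs My) => //; apply: (in_closed _ vw); first exact: closed_span_closed.
  apply: cvg_distP => e e0; have [K Ke] := cvg_dist uy e0; exists K => n /Ke.
  by rewrite -wu.
- split=> [|a _ _ [y <- vy] [z <- vz]].
    by exists 0 => //; exact: (lin_sub0 (closed_span_lin _)).
  by exists (a *: y + z) => //; exact: (closed_span_lin _).2.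
- by move=> _ [i _ <-]; exists (v i) => //; apply: closed_span_sub; exists i.
Qed.

End ClosedSubspaceType.

(** * GNS construction and Stinespring dilation *)

Section Orthocomplement.
Variables (R : realType) (E : hilbertType R).

(** Orthogonal projection: the functional [inner^~ x] restricted to the closed
    span is represented by a vector of the span, which must be [x] itself. *)
Lemma total_orthP (X : set E) :
  (forall x, (forall y, X y -> inner y x = 0) -> x = 0) -> closed_span X = setT.
Proof.
move=> X0; pose M := ClosedSubspace (@closed_span_closed _ _ X) (closed_span_lin X).
rewrite -subTset => x _.
have [p pP] : exists p : cs_type M, forall m : cs_type M, inner (cs_val m) x = inner m p.
  apply: (@riesz _ _ (fun m : cs_type M => inner (cs_val m) x) _ `|x|) => [a m n|m].
    by rewrite -innerZl -innerDl.
  by rewrite mulrC cs_normE inner_le_norm.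
suff <- : cs_val p = x by exact: (cs_valP p).
apply/eqP; rewrite -subr_eq0; apply/eqP/X0 => y Xy; rewrite innerBr.
have My : cs_set M y by exact: closed_span_sub.
by have := pP (to_cs My); rewrite cs_innerE /= => ->; rewrite subrr.
Qed.

Lemma separable_dense_seq : separable_space E ->
  exists a : nat -> E, forall x (e : R[i]), 0 < e -> exists n, `|x - a n| < e.
Proof.
move=> [A /countable_injP[f finj] Ad].
exists (fun n => xget 0 [set x | A x /\ f x = n]) => x e e0.
have [||y []] := Ad (interior (ball x e)).
- by exists x; exact: nbhsx_ballx.
- exact: open_interior.
move=> /interior_subset; rewrite -ball_normE /= => xy Ay; exists (f y).
have [Az fz] := @xgetPex _ 0 [set x | A x /\ f x = f y]
  (ex_intro _ y (conj Ay erefl)).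
by rewrite (finj _ _ _ _ fz)//; exact: mem_set.
Qed.

End Orthocomplement.

Section GNS.
Variables (R : realType) (d : nat) (d_gt0 : (0 < d)%N).
Variables (F : full_fock R d) (H : hilbertType R).
Hypothesis H_separable : separable_space H.
Local Notation C := R[i].
Local Notation L := (creation F).
Local Notation A := (add_adj (free_disk_algebra F)).
Variable f : bop F F -> bop H H.
Hypothesis fcp : cp_on A f.

(** The inner product of [L^alpha (x) h] and [L^beta (x) g] in the GNS space. *)
Definition gns_kernel (x y : seq 'I_d * H) : C :=
  inner (f (bcomp (adj (word_op L y.1)) (word_op L x.1)) x.2) y.2.

Lemma gns_kernel_positive : positive_kernel gns_kernel.
Proof.
split=> [x y|s]; rewrite /gns_kernel.
  rewrite innerC; congr (_^*); rewrite -[in RHS](adjK (f _)) -adjPr.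
  rewrite -(cp_adj (free_disk_system F) fcp) ?adj_comp ?adjK//.
  exact: free_disk_toeplitz.
pose B (i j : 'I_(size s)) : bop F F :=
  bcomp (adj (word_op L (tnth (in_tuple s) i).1.1)) (word_op L (tnth (in_tuple s) j).1.1).
have BA i j : A (B i j) by exact: free_disk_toeplitz.
have Bpsd : psd B.
  move=> x; have := inner_ge0 (\sum_j word_op L (tnth (in_tuple s) j).1.1 (x j)).
  rewrite inner_suml; under eq_bigr do rewrite inner_sumr.
  rewrite exchange_big /=; congr (0 <= _).
  by apply: eq_bigr => i _; apply: eq_bigr => j _; rewrite adjPr.
have := fcp.2 _ _ BA Bpsd (fun i => (tnth (in_tuple s) i).2 *: (tnth (in_tuple s) i).1.2).
rewrite [in X in _ -> X](big_tnth _ _ s) exchange_big /=; congr (0 <= _).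
apply: eq_bigr => j _; rewrite (big_tnth _ _ s); apply: eq_bigr => i _.
by rewrite bopZ innerZl innerZr mulrA.
Qed.

(** All the operators [L^alpha^* L^alpha] are [I], so the distance of
    [(alpha, h)] and [(alpha, a)] in the seminorm of the kernel is controlled by
    [`|h - a|]. *)
Lemma gns_kernel_dense (a : nat -> H) :
  (forall x (e : C), 0 < e -> exists n, `|x - a n| < e) ->
  exists q : nat -> seq 'I_d * H, forall x (e : C), 0 < e ->
    exists n, gns_kernel x x - gns_kernel x (q n) - gns_kernel (q n) x
              + gns_kernel (q n) (q n) < e.
Proof.
move=> ad.
pose q m : seq 'I_d * H :=
  if unpickle m is Some (alpha, n) then (alpha, a n) else ([::], 0).
exists q => -[alpha h] e e0; pose c := `|f (bid F)| + 1.
have c0 : 0 < c by rewrite ltr_pwDr.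
have [|n hn] := ad h (sqrtC (e / c)); first by rewrite sqrtC_gt0 divr_gt0.
exists (pickle (alpha, n)); rewrite /q pickleK /gns_kernel /= toeplitz_diag.
have -> : inner (f (bid F) h) h - inner (f (bid F) h) (a n) - inner (f (bid F) (a n)) h
    + inner (f (bid F) (a n)) (a n) = inner (f (bid F) (h - a n)) (h - a n).
  by rewrite bopB innerBl !innerBr; ring.
have hn2 : `|h - a n| ^+ 2 < e / c.
  rewrite -[e / c]sqrtCK ltr_pXn2r// ?nnegrE// sqrtC_ge0 divr_ge0// ltW//.
rewrite ltr_pdivlMr// mulrC in hn2; apply: le_lt_trans hn2.
rewrite -[leLHS]ger0_norm ?(cp1_ge0 (free_disk_system F) fcp)//.
rewrite (le_trans (inner_le_norm _ _))// expr2 mulrA ler_wpM2r//.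
by rewrite (le_trans (bop_norm_le _ _))// ler_wpM2r// lerDl.
Qed.

(** The GNS space of [f]: it is realised inside [F], which is large enough because
    [H] is separable and [F] contains an orthonormal sequence. *)
Lemma gns_space : exists (J : hilbertType R) (v : seq 'I_d * H -> J),
  closed_span (range v) = setT /\ forall x y, inner (v x) (v y) = gns_kernel x y.
Proof.
have [a /gns_kernel_dense[q qd]] := separable_dense_seq H_separable.
pose e n := fock_basis F (nseq n (Ordinal d_gt0)).
have eo : orthonormal_seq e.
  move=> i j; rewrite fock_orthonormal; congr (_%:R); congr nat_of_bool.
  apply/eqP/eqP => [|->//] /(congr1 size); by rewrite !size_nseq.
have [v0 v0k] := kernel_realization eo gns_kernel_positive qd.
pose M := ClosedSubspace (@closed_span_closed _ _ (range v0)) (closed_span_lin (range v0)).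
have v0M x : cs_set M (v0 x) by apply: closed_span_sub; exists x.
exists (cs_type M : hilbertType R), (fun x => to_cs (v0M x)); split; last exact: v0k.
exact: cs_total.
Qed.

(** Prefixing a letter to a word preserves the GNS kernel up to [(i == j)], so it
    defines a [d]-isometry on the GNS space; [W] sends [H] to the vectors at the
    empty word. *)
Lemma row_isometric_dilation : exists (J : hilbertType R) (D : bop (hsum d J) J)
    (W : bop H J), [/\ isometric D,
      forall alpha h g, inner (word_op (row_comp D) alpha (W h)) (W g) =
        inner (f (word_op L alpha) h) g
    & closed_span (range (fun x : seq 'I_d * H => word_op (row_comp D) x.1 (W x.2))) = setT].
Proof.
have [J [v [vt vk]]] := gns_space.
have vlin : linear (fun h => v ([::], h)).
  move=> a h g; apply: (total_inner_inj vt) => _ [x _ <-].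
  by rewrite innerDl innerZl !vk /gns_kernel /= bopD bopZ innerDl innerZl.
have Wb : bounded_linear (fun h => v ([::], h)).
  split=> //; exists (sqrtC `|f (bid F)|) => h.
  rewrite -(@ler_pXn2r _ 2%N)// ?nnegrE ?mulr_ge0 ?sqrtC_ge0// exprMn sqrtCK.
  rewrite -inner_norm vk /gns_kernel /= -[bcomp _ _]/(bcomp (adj (word_op L [::])) (word_op L [::])).
  rewrite toeplitz_diag -[leLHS]ger0_norm ?(cp1_ge0 (free_disk_system F) fcp)//.
  rewrite (le_trans (inner_le_norm _ _))// expr2 mulrA ler_wpM2r//.
  exact: bop_norm_le.
pose I := ('I_d * (seq 'I_d * H))%type.
pose x (i : I) : hsum d J := hsum_inj i.1 (v i.2).
pose y (i : I) : J := v (i.1 :: i.2.1, i.2.2).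
have xt : closed_span (range x) = setT.
  rewrite -(hsum_total d vt); congr closed_span; apply/seteqP; split.
    by move=> _ [[j p] _ <-]; exists j => //; exists (v p) => //; exists p.
  by move=> _ [j _ [_ [p _ <-] <-]]; exists (j, p).
have xy i j : inner (x i) (x j) = inner (y i) (y j).
  move: i j; move=> [i [alpha h]] [j [beta g]]; rewrite /x /y hsum_inj_inner !vk /gns_kernel /=.
  by rewrite -/(word_op L (_ :: _)) toeplitz_cons (cpZ (free_disk_system F) fcp) ?bopZE ?innerZl
    1?eq_sym//; exact: free_disk_toeplitz.
have [D [Diso Dx]] := isometry_extension xt xy.
have Dv alpha h : word_op (row_comp D) alpha (to_bop Wb h) = v (alpha, h).
  elim: alpha => //= j alpha ->; exact: (Dx (j, (alpha, h))).
exists J, D, (to_bop Wb); split=> // [alpha h g|].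
  rewrite Dv /= vk /gns_kernel /=; congr (inner (f _ _) _); apply: bopE => z /=.
  by rewrite adj_id.
suff -> : (fun x => word_op (row_comp D) x.1 (to_bop Wb x.2)) = v by [].
by apply/funext => -[alpha h]; exact: Dv.
Qed.

End GNS.

(** * Extensions of the Herglotz isometry and their moments *)

Section Extensions.
Variables (R : realType) (d : nat) (H : hilbertType R).
Variable b : @unit_ball R d -> bop H H.
Variables (Lb : rkhs (herglotz_kernel b)) (V : bop (hsum d Lb) Lb).
Hypothesis V_def : is_herglotz_isometry V.
Local Notation C := R[i].
Local Notation B := (@unit_ball R d).
Local Notation K0 := (kfun Lb (Defs.ball0 R d)).

Lemma kfun_inner (w z : B) h g :
  inner (kfun Lb w h) (kfun Lb z g) = inner (herglotz_kernel b z w h) g.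
Proof. by rewrite -(rk_kernel Lb) -adjP. Qed.

(** A function orthogonal to all [K_z g] vanishes at every [z]. *)
Lemma kfun_total : closed_span (range (fun p : B * H => kfun Lb p.1 p.2)) = setT.
Proof.
apply: total_orthP => x xK; apply: (rk_ext (r := Lb)) => z; rewrite bop0.
apply: inner_inj => g; rewrite inner0l adjP.
by rewrite innerC xK ?rmorph0//; exists (z, g).
Qed.

(** The kernel is determined by its values [K 0 w], since its numerator is a sum
    of a function of [z] and a function of [w]. *)
Lemma herglotz_kernel_split (z w : B) : 1 - cdot (val z) (val w) != 0 ->
  (1 - cdot (val z) (val w)) *: herglotz_kernel b z w =
  herglotz_kernel b (Defs.ball0 R d) w + adj (herglotz_kernel b (Defs.ball0 R d) z)
    - herglotz_kernel b (Defs.ball0 R d) (Defs.ball0 R d).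
Proof.
have cdot0 (v : B) : cdot (val (Defs.ball0 R d)) (val v) = 0.
  by rewrite /cdot big1// => j _; rewrite mxE mul0r.
move=> zw; rewrite /herglotz_kernel !cdot0 subr0 divr1.
rewrite scalerA mulrCA divff// mulr1.
rewrite adjZ adjD adjK.
have -> : (2^-1 : C)^* = 2^-1 by rewrite fmorphV rmorph_nat.
rewrite -scalerDr -scalerBr; congr (_ *: _).
set h0 := herglotz b (Defs.ball0 R d); set hz := herglotz b z; set hw := herglotz b w.
by rewrite [h0 + adj hw + _]addrACA [RHS]addrAC subrr add0r addrC.
Qed.

Lemma hsum_map_bounded (E F : hilbertType R) (T : bop E F) :
  bounded_linear (hsum_map (d := d) T).
Proof.
split=> [a x y|]; first by apply/ffunP => j; rewrite !ffunE bopD bopZ.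
exists `|T| => x; rewrite -(@ler_pXn2r _ 2%N)// ?nnegrE ?mulr_ge0//.
rewrite exprMn !hsum_normE mulr_sumr; apply: ler_sum => j _.
by rewrite ffunE -exprMn ler_pXn2r ?nnegrE ?mulr_ge0// bop_norm_le.
Qed.

Lemma row_op_wstar (J : hilbertType R) (D : bop (hsum d J) J) (E : bop Lb J)
    (w : B) h :
  D (hsum_map E (wstar_kfun Lb w h)) = row_dot (row_comp D) (val w) (E (kfun Lb w h)).
Proof.
rewrite row_opE row_dotE; apply: eq_bigr => j _.
by rewrite !ffunE !bopZ.
Qed.

Lemma resolvent_eq (J : hilbertType R) (S : 'I_d -> bop J J) (w : B) (x y : J) :
  row_isometric S -> x - row_dot S (val w) x = y ->
  opinv (bid J - row_dot S (val w)) y = x.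
Proof.
move=> Siso <-; have [inv _ _] := neumann (row_dot_norm Siso w).
by have := congr1 (fun T : bop J J => T x) inv.
Qed.

Lemma resolvent_diff (J : hilbertType R) (S : 'I_d -> bop J J) (w : B) (y : J) :
  row_isometric S ->
  let x := opinv (bid J - row_dot S (val w)) y in x - row_dot S (val w) x = y.
Proof.
move=> Siso; have [_ inv _] := neumann (row_dot_norm Siso w).
by have := congr1 (fun T : bop J J => T y) inv.
Qed.

Section Moments.
Variable D : isometric_extension V.
Local Notation S := (row_comp (ext_op D)).
Local Notation W := (bcomp (ext_emb D) K0).

(** The moments [K_0^* D^alpha K_0], tested on vectors of [H]. *)
Definition ext_moment alpha h g : C := inner (word_op S alpha (W h)) (W g).

Lemma ext_row_isometric : row_isometric S.
Proof. by apply: row_comp_isometric; exact: ext_isometry. Qed.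

(** As an extension of [V] sends [w^* K_w h] to [K_w h - K_0 h], the vector [K_w h]
    is the solution [x] of [x - D w^* x = K_0 h]. *)
Lemma ext_resolvent (w : B) h :
  opinv (bid _ - row_dot S (val w)) (W h) = ext_emb D (kfun Lb w h).
Proof.
apply: resolvent_eq ext_row_isometric _.
rewrite -row_op_wstar ext_extends.
  by have [_ ->] := V_def; rewrite bopB opprB addrC subrK.
by apply: closed_span_sub; exists w => //; exists h.
Qed.

Lemma ext_total :
  closed_span (range (fun x : seq 'I_d * H => word_op S x.1 (W x.2))) = setT.
Proof.
rewrite -(ext_cyclic D); congr closed_span; apply/seteqP; split.
  by move=> _ [[alpha h] _ <-]; exists alpha => //; exists h => //; rewrite row_wordE.
by move=> _ [alpha _ [h _ <-]]; exists (alpha, h) => //; rewrite row_wordE.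
Qed.

End Moments.

(** The components of a [d]-isometry are isometries with orthogonal ranges, so the
    Gram matrix of the cyclic vectors reduces to moments by cancelling first
    letters. *)
Lemma gram_moments (J1 J2 : hilbertType R) (S1 : 'I_d -> bop J1 J1)
    (S2 : 'I_d -> bop J2 J2) (W1 : bop H J1) (W2 : bop H J2) :
  row_isometric S1 -> row_isometric S2 ->
  (forall alpha h g, inner (word_op S1 alpha (W1 h)) (W1 g) =
                     inner (word_op S2 alpha (W2 h)) (W2 g)) ->
  forall alpha beta h g,
    inner (word_op S1 alpha (W1 h)) (word_op S1 beta (W1 g)) =
    inner (word_op S2 alpha (W2 h)) (word_op S2 beta (W2 g)).
Proof.
move=> iso1 iso2 mom; elim=> [|i alpha IH] [|j beta] h g.
- exact: (mom [::]).
- by rewrite innerC [RHS]innerC; congr (_^*); exact: mom.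
- exact: (mom (i :: alpha)).
- by rewrite (word_op_toeplitz iso1) (word_op_toeplitz iso2) IH.
Qed.

(** Equality of moments is equality of the Gram matrices of the cyclic vectors,
    which yields the unitary.  It is the identity on the Herglotz space because
    it intertwines the resolvents that produce the vectors [K_w h]. *)
Lemma ext_equiv_moment (D1 D2 : isometric_extension V) :
  ext_equiv D1 D2 <-> forall alpha h g, ext_moment D1 alpha h g = ext_moment D2 alpha h g.
Proof.
split=> [[U [Uiso _ UD UE]] alpha h g|mom].
  have US alpha' x : U (word_op (row_comp (ext_op D1)) alpha' x) =
      word_op (row_comp (ext_op D2)) alpha' (U x).
    elim: alpha' => //= j alpha' IH; rewrite UD; congr (ext_op D2 _).
    by apply/ffunP => k; rewrite !ffunE -IH; case: eqP => // _; rewrite bop0.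
  by rewrite /ext_moment -(isometric_inner _ _ Uiso) US /= !UE.
have iso1 := @ext_row_isometric D1; have iso2 := @ext_row_isometric D2.
have [U [Uiso Uonto Ux]] := unitary_extension (ext_total D1) (ext_total D2)
  (fun x y => gram_moments iso1 iso2 mom x.1 y.1 x.2 y.2).
have UW h : U (ext_emb D1 (K0 h)) = ext_emb D2 (K0 h) by exact: (Ux ([::], h)).
have UD x : U (ext_op D1 x) = ext_op D2 (hsum_map U x).
  apply: (congr1 (fun T : bop _ _ => T x)
    (x := bcomp U (ext_op D1)) (y := bcomp (ext_op D2) (to_bop (hsum_map_bounded U)))).
  apply: (total_bop_eq (hsum_total d (ext_total D1))) => _ [j _ [_ [[alpha h] _ <-] <-]].
  have -> : bcomp (ext_op D2) (to_bop (hsum_map_bounded U))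
      (hsum_inj j (word_op (row_comp (ext_op D1)) alpha (ext_emb D1 (K0 h)))) =
      ext_op D2 (hsum_inj j (U (word_op (row_comp (ext_op D1)) alpha (ext_emb D1 (K0 h))))).
    congr (ext_op D2 _); apply/ffunP => k; rewrite !ffunE.
    by case: eqP => // _; rewrite bop0.
  by rewrite (Ux (alpha, h)); exact: (Ux (j :: alpha, h)).
exists U; split=> // f.
apply: (congr1 (fun T : bop _ _ => T f) (x := bcomp U (ext_emb D1)) (y := ext_emb D2)).
apply: (total_bop_eq kfun_total) => _ [[w h] _ <-] /=.
rewrite -[RHS]ext_resolvent; apply: esym; apply: resolvent_eq iso2 _.
rewrite -[bcomp _ _ h]UW -[ext_emb D1 (K0 h)](resolvent_diff w _ iso1).
rewrite [opinv _ _]ext_resolvent bopB; congr (_ - _).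
rewrite !row_dotE bopsum; apply: eq_bigr => j _; rewrite bopZ; congr (_ *: _).
rewrite /= UD; congr (ext_op D2 _).
by apply/ffunP => k; rewrite !ffunE; case: eqP => // _; rewrite bop0.
Qed.

Variables (d_gt0 : (0 < d)%N) (F : full_fock R d).
Hypothesis H_separable : separable_space H.
Local Notation L := (creation F).

(** [z w^*] is the inner product of [L w^* e] and [L z^* e] for the vacuum vector
    [e], and both operators have norm less than [1]. *)
Lemma cdot_neq1 (z w : B) : 1 - cdot (val z) (val w) != 0.
Proof.
have Liso := creation_row_isometric (F := F); pose e := fock_basis F [::].
have ee : inner e e = 1 by rewrite fock_orthonormal.
have e1 : `|e| = 1.
  by apply/eqP; rewrite -(@eqrXn2 _ 2%N)// -inner_norm ee expr1n.
apply/negP; rewrite subr_eq0 => /eqP zw.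
have := row_dot_inner Liso (val z) (val w) e e; rewrite -zw ee mul1r => one.
have : `|inner (row_dot L (val w) e) (row_dot L (val z) e)| < 1.
  apply: (le_lt_trans (inner_le_norm _ _)); rewrite -[ltRHS]mulr1.
  by apply: ltr_pM => //; apply: (le_lt_trans (bop_norm_le _ _));
    rewrite e1 mulr1 row_dot_norm.
by rewrite one normr1 ltxx.
Qed.

(** The dilation of an extension of [mu_b] contains a copy of the Herglotz space:
    [K_w h] corresponds to the resolvent at [w] applied to [h]. *)
Lemma extension_of_cp (f : bop F F -> bop H H) :
  cp_on (add_adj (free_disk_algebra F)) f ->
  (forall w : B, f (opinv (bid F - Lstar F (val w))) = herglotz_kernel b (Defs.ball0 R d) w) ->
  exists D : isometric_extension V, forall alpha h g,
    ext_moment D alpha h g = inner (f (word_op L alpha) h) g.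
Proof.
move=> fcp fR; have [J [D [W [Diso DW Dt]]]] := row_isometric_dilation d_gt0 H_separable fcp.
have Siso := row_comp_isometric Diso; set S := row_comp D in Siso DW Dt.
pose u (p : B * H) : J := opinv (bid J - row_dot S (val p.1)) (W p.2).
have uW w h g : inner (u (w, h)) (W g) = inner (herglotz_kernel b (Defs.ball0 R d) w h) g.
  by rewrite -fR (cp_resolvent Siso fcp (fun a x y => esym (DW a x y))).
have u0 h : u (Defs.ball0 R d, h) = W h.
  apply: (resolvent_eq Siso).
  by rewrite row_dotE big1 ?subr0// => j _; rewrite mxE rmorph0 scale0r.
have Ku p q : inner (kfun Lb p.1 p.2) (kfun Lb q.1 q.2) = inner (u p) (u q).
  case: p q => w h [z g]; apply: (mulfI (cdot_neq1 z w)).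
  rewrite (row_resolvent_inner Siso (resolvent_diff w _ Siso) (resolvent_diff z _ Siso)).
  rewrite kfun_inner -innerZl -bopZE herglotz_kernel_split ?cdot_neq1//.
  rewrite bopBE bopDE innerBl innerDl -[inner (opinv _ _) _]/(inner (u (w, h)) (W g)) uW.
  congr (_ + _ - _).
    by rewrite -adjPr innerC -uW -innerC.
  by rewrite -(uW (Defs.ball0 R d) h g) u0.
have [E [Eiso EK]] := isometry_extension kfun_total Ku.
have EK0 h : E (K0 h) = W h.
  by rewrite (EK (Defs.ball0 R d, h)) u0.
have DV x : herglotz_init Lb x -> D (hsum_map E x) = E (V x).
  apply: (bop_eq_closed_span (S := bcomp D (to_bop (hsum_map_bounded E)))
    (T := bcomp E V)) => _ [w _ [h _ <-]] /=.
  rewrite row_op_wstar; have [_ ->] := V_def; rewrite bopB EK0 (EK (w, h)).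
  by rewrite -[in RHS](resolvent_diff w (W h) Siso) opprB addrC subrK.
have Dcyc : closed_span [set row_word D alpha (E (K0 h)) | alpha in setT & h in setT] = setT.
  rewrite -Dt; congr closed_span; apply/seteqP; split.
    by move=> _ [alpha _ [h _ <-]]; exists (alpha, h) => //; rewrite row_wordE EK0.
  by move=> _ [[alpha h] _ <-]; exists alpha => //; exists h => //; rewrite row_wordE EK0.
exists (IsometricExtension Eiso Diso DV Dcyc) => alpha h g.
by rewrite /ext_moment /= !EK0 DW.
Qed.

(** Conversely, the moments of an extension of [V] force the values on resolvents
    prescribed by [mu_b]. *)
Lemma cp_of_extension_resolvent (D : isometric_extension V)
    (f : bop F F -> bop H H) (w : B) :
  cp_on (add_adj (free_disk_algebra F)) f ->
  (forall alpha h g, ext_moment D alpha h g = inner (f (word_op L alpha) h) g) ->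
  f (opinv (bid F - Lstar F (val w))) = herglotz_kernel b (Defs.ball0 R d) w.
Proof.
move=> fcp fD; apply: bopE => h; apply: inner_inj => g.
rewrite (cp_resolvent (@ext_row_isometric D) fcp (fun a x y => esym (fD a x y))).
by rewrite ext_resolvent /= (isometric_inner _ _ (@ext_emb_isometry _ _ _ _ _ _ D)) kfun_inner.
Qed.

End Extensions.

(** * The Poisson transform of a row isometry *)

Section WordLists.
Variable d : nat.

Fixpoint words_of_size k : seq (seq 'I_d) :=
  if k is k'.+1 then [seq j :: alpha | j <- enum 'I_d, alpha <- words_of_size k']
  else [:: [::]].

Definition words_below N : seq (seq 'I_d) :=
  flatten [seq words_of_size k | k <- iota 0 N].

Lemma mem_words_of_size k alpha : (alpha \in words_of_size k) = (size alpha == k).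
Proof.
elim: k alpha => [|k IH] alpha /=; first by rewrite inE size_eq0.
apply/allpairsP/idP => [[[j beta] /= [_ + ->]]|]; first by rewrite IH.
case: alpha => // j beta; rewrite eqSS => bk; exists (j, beta).
by rewrite mem_enum /= IH.
Qed.

Lemma uniq_words_of_size k : uniq (words_of_size k).
Proof.
elim: k => //= k IH; apply: allpairs_uniq => //; first exact: enum_uniq.
by move=> [i alpha] [j beta] _ _ /= [-> ->].
Qed.

Lemma words_belowS N : words_below N.+1 = words_below N ++ words_of_size N.
Proof. by rewrite /words_below -addn1 iotaD map_cat flatten_cat /= cats0. Qed.

Lemma mem_words_below N alpha : (alpha \in words_below N) = (size alpha < N)%N.
Proof.
elim: N => // N IH; rewrite words_belowS mem_cat IH mem_words_of_size.
by rewrite orbC [RHS]ltnS [RHS]leq_eqVlt.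
Qed.

Lemma uniq_words_below N : uniq (words_below N).
Proof.
elim: N => // N IH; rewrite words_belowS cat_uniq IH uniq_words_of_size andbT /=.
apply/hasPn => alpha; rewrite mem_words_of_size mem_words_below => /eqP ->.
by rewrite ltnn.
Qed.

Lemma sum_words_below (U : nmodType) N (f : seq 'I_d -> U) :
  \sum_(alpha <- words_below N) f alpha =
  \sum_(k < N) \sum_(alpha <- words_of_size k) f alpha.
Proof.
elim: N => [|N IH]; first by rewrite big_nil big_ord0.
by rewrite words_belowS big_cat IH big_ord_recr.
Qed.

End WordLists.

Section PoissonTransform.
Variables (R : realType) (d : nat) (F : full_fock R d).
Variables (J : hilbertType R) (S : 'I_d -> bop J J).
Hypothesis Siso : row_isometric S.
Local Notation C := R[i].
Local Notation L := (creation F).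
Local Notation e := (fock_basis F).

(** The map [X |-> sum_j S_j X S_j^*]; its iterates at [I] are the projections onto
    the ranges of the words of a given length, and at the first step [DD^*]. *)
Definition conj_sum (X : bop J J) : bop J J :=
  \sum_j bcomp (S j) (bcomp X (adj (S j))).

Local Notation P := (conj_sum (bid J)).

Lemma conj_sumE X x : conj_sum X x = \sum_j S j (X (adj (S j) x)).
Proof. by rewrite /conj_sum bopsumE; apply: eq_bigr. Qed.

Lemma conj_sumBZ a X Y : conj_sum (X - a *: Y) = conj_sum X - a *: conj_sum Y.
Proof.
apply: bopE => x; rewrite [RHS]bopBE bopZE !conj_sumE scaler_sumr -sumrB.
by apply: eq_bigr => j _; rewrite bopBE bopZE bopB bopZ.
Qed.

Lemma adj_row_cancel i j x : adj (S i) (S j x) = (i == j)%:R *: x.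
Proof.
by apply: inner_inj => y; rewrite -adjPr Siso innerZl eq_sym.
Qed.

Lemma conj_sum_norm2 X x :
  inner (conj_sum X x) (conj_sum X x) =
  \sum_j inner (X (adj (S j) x)) (X (adj (S j) x)).
Proof.
rewrite conj_sumE inner_suml; apply: eq_bigr => i _.
rewrite inner_sumr (bigD1 i)//= Siso eqxx mul1r big1 ?addr0// => j ji.
by rewrite Siso eq_sym (negbTE ji) mul0r.
Qed.

Lemma range_proj_inner x : inner (P x) x = inner (P x) (P x).
Proof.
rewrite conj_sum_norm2 conj_sumE inner_suml; apply: eq_bigr => j _ /=.
by rewrite adjP.
Qed.

(** The norm of [x - P x] is nonnegative. *)
Lemma bessel x : inner (P x) (P x) <= inner x x.
Proof.
rewrite -subr_ge0; have := inner_ge0 (x - P x).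
rewrite innerBl !innerBr range_proj_inner [inner x (P x)]innerC range_proj_inner.
by rewrite -[(inner (P x) (P x))^*]innerC opprB addrA subrK.
Qed.

Lemma conj_sum_norm X : `|conj_sum X| <= `|X|.
Proof.
apply: opnorm_le => // x.
rewrite -(@ler_pXn2r _ 2%N)// ?nnegrE ?mulr_ge0// -inner_norm conj_sum_norm2.
apply: (@le_trans _ _ (`|X| ^+ 2 * inner (P x) (P x))).
  rewrite conj_sum_norm2 mulr_sumr; apply: ler_sum => j _ /=.
  by rewrite !inner_norm -exprMn ler_pXn2r ?nnegrE ?mulr_ge0// bop_norm_le.
by rewrite exprMn ler_wpM2l ?exprn_ge0// -inner_norm bessel.
Qed.

Lemma sum_words_of_size k X :
  \sum_(alpha <- words_of_size d k)
    bcomp (word_op S alpha) (bcomp X (adj (word_op S alpha))) = iter k conj_sum X.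
Proof.
elim: k => [|k IH].
  by rewrite big_seq1; apply: bopE => x /=; rewrite adj_id.
rewrite big_allpairs_dep /= big_enum /= -IH /conj_sum; apply: eq_bigr => j _.
apply: bopE => x; rewrite bopsumE /= bopsumE bopsum; apply: eq_bigr => alpha _.
by rewrite /= adj_comp.
Qed.

Lemma conj_sum_iter_norm k : `|iter k conj_sum (bid J)| <= 1.
Proof.
elim: k => [|k IH]; first exact: bid_norm.
exact: le_trans (conj_sum_norm _) IH.
Qed.

Section Radius.
Variable r : C.
Hypotheses (r_ge0 : 0 <= r) (r_le1 : r <= 1).

(** The square root of [I - r^2 DD^*]: as [DD^*] is a projection, no functional
    calculus is needed. *)
Definition defect : bop J J := bid J - P + sqrtC (1 - r ^+ 2) *: P.

Lemma range_proj_adj : adj P = P.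
Proof.
apply: adj_uniq => x y; rewrite !conj_sumE inner_suml inner_sumr.
by apply: eq_bigr => j _ /=; rewrite adjP [RHS]adjPr.
Qed.

Lemma range_proj_idem x : P (P x) = P x.
Proof.
rewrite [LHS]conj_sumE [RHS]conj_sumE; apply: eq_bigr => i _ /=; congr (S i _).
rewrite conj_sumE bopsum (bigD1 i)//= adj_row_cancel eqxx scale1r big1 ?addr0// => j ji.
by rewrite adj_row_cancel eq_sym (negbTE ji) scale0r.
Qed.

Let s0 : 0 <= 1 - r ^+ 2.
Proof. by rewrite subr_ge0 exprn_ile1. Qed.

Lemma defect_adj : adj defect = defect.
Proof.
rewrite /defect adjD adjB adj_id adjZ range_proj_adj; congr (_ + _ *: _).
by apply/CrealP; rewrite ger0_real// sqrtC_ge0.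
Qed.

Lemma defect_sqr : bcomp defect defect = bid J - r ^+ 2 *: P.
Proof.
have dE x : defect x = (x - P x) + sqrtC (1 - r ^+ 2) *: P x.
  by rewrite /defect bopDE bopBE bopZE.
have Pd x : P (defect x) = sqrtC (1 - r ^+ 2) *: P x.
  by rewrite dE bopD bopB bopZ range_proj_idem subrr add0r.
apply: bopE => x; rewrite [RHS]bopBE bopZE -[LHS]/(defect (defect x)).
rewrite dE Pd dE addrK scalerA -expr2 sqrtCK scalerBl scale1r addrA subrK.
by [].
Qed.

(** The Poisson kernel of radius [r], as a family indexed by the basis of the Fock
    space. *)
Definition poisson_vec (alpha : seq 'I_d) : bop J J :=
  r ^+ size alpha *: bcomp defect (adj (word_op S alpha)).

Definition poisson (N : nat) (T : bop F F) : bop J J :=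
  \sum_(alpha <- words_below d N) \sum_(beta <- words_below d N)
    inner (T (e beta)) (e alpha) *: bcomp (adj (poisson_vec alpha)) (poisson_vec beta).

Lemma poisson_inner N T x y : inner (poisson N T x) y =
  \sum_(alpha <- words_below d N) \sum_(beta <- words_below d N)
    inner (T (e beta)) (e alpha) * inner (poisson_vec beta x) (poisson_vec alpha y).
Proof.
rewrite /poisson bopsumE inner_suml; apply: eq_bigr => alpha _.
rewrite bopsumE inner_suml; apply: eq_bigr => beta _.
by rewrite bopZE innerZl /= -adjPr.
Qed.

Lemma poisson_cp N : cp_on setT (poisson N).
Proof.
split=> [a T1 T2 _ _|n A _ Apsd x].
  apply: bopE => x; apply: inner_inj => y.
  rewrite bopDE bopZE innerDl innerZl !poisson_inner mulr_sumr -big_split /=.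
  apply: eq_bigr => alpha _; rewrite mulr_sumr -big_split /=.
  by apply: eq_bigr => beta _; rewrite ?bopDE ?bopZE innerDl innerZl mulrDl mulrA.
have := psd_schur (words_below d N) e (fun i beta => poisson_vec beta (x i)) Apsd.
congr (0 <= _); apply: eq_bigr => i _; apply: eq_bigr => j _.
by rewrite poisson_inner.
Qed.

(** Among the pairs of words only those of the form [(gamma beta, beta)]
    contribute.  Writing [P_k] for the [k]-th iterate of [conj_sum] at [I], the
    words [beta] of length [k] add up to [r^(2k) P_k - r^(2k+2) P_(k+1)], and the
    sum over [k] telescopes. *)
Lemma poisson_word N gamma : poisson N (word_op L gamma) =
  r ^+ size gamma *: bcomp (word_op S gamma)
    (bid J - r ^+ (2 * (N - size gamma)) *: iter (N - size gamma) conj_sum (bid J)).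
Proof.
set m := size gamma.
pose G beta : bop J J := r ^+ (m + 2 * size beta) *: bcomp (word_op S gamma)
  (bcomp (word_op S beta) (bcomp (bcomp defect defect) (adj (word_op S beta)))).
have GE beta : bcomp (adj (poisson_vec (gamma ++ beta))) (poisson_vec beta) = G beta.
  have rr k : (r ^+ k)^* = r ^+ k by apply/CrealP; rewrite ger0_real// exprn_ge0.
  rewrite /poisson_vec adjZ rr adj_comp adjK defect_adj word_op_cat size_cat.
  apply: bopE => x; transitivity (r ^+ (m + size beta) *: word_op S gamma
    (word_op S beta (defect (r ^+ size beta *: defect (adj (word_op S beta) x))))) => //.
  rewrite !bopZ scalerA -exprD -addnA addnn -mul2n //.
have -> : poisson N (word_op L gamma) = \sum_(beta <- words_below d (N - m)) G beta.
  rewrite /poisson exchange_big /=.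
  transitivity (\sum_(beta <- words_below d N | (size beta < N - m)%N) G beta).
    rewrite [RHS]big_mkcond /=; apply: eq_bigr => beta _.
    have -> : (size beta < N - m)%N = (gamma ++ beta \in words_below d N).
      by rewrite mem_words_below size_cat ltn_subRL.
    case: ifPn => gb.
      rewrite (bigD1_seq (gamma ++ beta)) ?uniq_words_below//= big1 ?addr0 => [|alpha ag].
        by rewrite word_op_fock fock_orthonormal eqxx scale1r GE.
      by rewrite word_op_fock fock_orthonormal eq_sym (negbTE ag) scale0r.
    rewrite big_seq big1// => alpha aW; rewrite word_op_fock fock_orthonormal.
    by case: eqP => [gba|_]; [rewrite gba aW in gb|rewrite scale0r].
  rewrite -[LHS]big_filter; apply: perm_big; apply: uniq_perm; rewrite ?filter_uniq ?uniq_words_below//.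
  move=> beta; rewrite mem_filter !mem_words_below andb_idr// => h.
  by rewrite (leq_trans h)// leq_subr.
rewrite sum_words_below.
have layer k : \sum_(beta <- words_of_size d k) G beta =
    r ^+ m *: bcomp (word_op S gamma) (r ^+ (2 * k) *: iter k conj_sum (bid J) -
      r ^+ (2 * k.+1) *: iter k.+1 conj_sum (bid J)).
  transitivity (r ^+ m *: bcomp (word_op S gamma)
      (r ^+ (2 * k) *: iter k conj_sum (bcomp defect defect))).
    rewrite -sum_words_of_size bcompZr scalerA bcomp_sumr scaler_sumr.
    rewrite big_seq [RHS]big_seq; apply: eq_bigr => beta.
    by rewrite mem_words_of_size /G exprD => /eqP ->.
  congr (_ *: bcomp _ _); rewrite defect_sqr.
  have -> : iter k conj_sum (bid J - r ^+ 2 *: P) =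
      iter k conj_sum (bid J) - r ^+ 2 *: iter k.+1 conj_sum (bid J).
    by rewrite iterSr; elim: k => //= k ->; exact: conj_sumBZ.
  by rewrite scalerBr scalerA -exprD mulnS addnC.
under eq_bigr do rewrite layer.
elim: (N - m)%N => [|K IH].
  rewrite big_ord0 muln0 expr0 scale1r /= subrr.
  by apply: bopE => x; rewrite bopZE /= bop0 scaler0.
rewrite big_ord_recr IH /= -scalerDr -bcompDr; congr (_ *: bcomp _ _).
by rewrite addrA subrK.
Qed.

Lemma poisson_norm N T : `|poisson N T| <= `|T|.
Proof.
have sysT : operator_system (setT : set (bop F F)).
  by split=> //; exact: closedT.
rewrite -[leRHS]mul1r; apply: (cp_norm sysT (poisson_cp N)) => // x.
have -> : poisson N (bid F) = bid J - r ^+ (2 * N) *: iter N conj_sum (bid J).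
  rewrite -[bid F]/(word_op L [::]) poisson_word -[size [::]]/0%N expr0 scale1r subn0.
  exact: bopE.
rewrite bopBE innerBl bopZE innerZl mul1r -inner_norm lerBlDl lerDr.
rewrite mulr_ge0 ?exprn_ge0// -sum_words_of_size.
rewrite bopsumE inner_suml; apply: sumr_ge0 => alpha _ /=.
by rewrite adjP inner_ge0.
Qed.

Lemma word_op_isometric gamma : isometric (word_op S gamma).
Proof.
elim: gamma => // j gamma IH x; rewrite -[RHS]IH; apply: norm_inner_eq.
by rewrite /= Siso eqxx mul1r.
Qed.

(** The two error terms come from the radius, by Bernoulli's inequality, and from
    the truncation. *)
Lemma poisson_word_dist N gamma : (size gamma <= N)%N ->
  `|word_op S gamma - poisson N (word_op L gamma)| <=
  (size gamma)%:R * (1 - r) + r ^+ N.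
Proof.
set m := size gamma => mN; rewrite poisson_word -/m.
have bernoulli k : 1 - r ^+ k <= k%:R * (1 - r).
  elim: k => [|k IH]; first by rewrite expr0 subrr mul0r.
  have -> : 1 - r ^+ k.+1 = (1 - r ^+ k) + r ^+ k * (1 - r) by rewrite exprS; ring.
  rewrite -natr1 mulrDl mul1r lerD// ler_piMl ?subr_ge0//.
  by rewrite exprn_ile1.
have Snorm : `|word_op S gamma| <= 1.
  by apply: opnorm_le => // x; rewrite mul1r word_op_isometric.
set Q := iter _ _ _.
have -> : word_op S gamma - r ^+ m *: bcomp (word_op S gamma) (bid J - r ^+ (2 * (N - m)) *: Q) =
    (1 - r ^+ m) *: word_op S gamma + r ^+ (m + 2 * (N - m)) *: bcomp (word_op S gamma) Q.
  rewrite -[- (_ *: Q)]scaleNr bcompDr bcompZr scaleNr.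
  have -> : bcomp (word_op S gamma) (bid J) = word_op S gamma by apply: bopE.
  by rewrite scalerBr scalerBl scale1r scalerA -exprD opprB addrA addrAC.
rewrite (le_trans (ler_normD _ _))// lerD//.
  rewrite normrZ ger0_norm ?subr_ge0 ?exprn_ile1//.
  by rewrite (le_trans _ (bernoulli m))// ler_piMr ?subr_ge0 ?exprn_ile1.
rewrite normrZ ger0_norm ?exprn_ge0//.
apply: (@le_trans _ _ (r ^+ (m + 2 * (N - m)))).
  rewrite ler_piMr ?exprn_ge0// (le_trans (bcomp_norm _ _))//.
  by rewrite mulr_ile1// conj_sum_iter_norm.
by apply: ler_wiXn2l => //; rewrite mul2n -addnn addnA subnKC// leq_addr.
Qed.

End Radius.

Lemma cvg_sum_ord n (u : 'I_n -> nat -> C^o) (l : 'I_n -> C^o) :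
  (forall i, u i @ \oo --> l i) ->
  (fun k => \sum_i u i k) @ \oo --> \sum_i l i.
Proof.
move=> ul; elim: (index_enum _) => [|i s IH].
  by rewrite big_nil; under eq_fun do rewrite big_nil; exact: cvg_cst.
by rewrite big_cons; under eq_fun do rewrite big_cons; exact: (cvgD (ul i) IH).
Qed.

(** Poisson transforms with radii tending to [1] converge in norm on words; being
    contractive, they converge on the operator system generated by the free disk
    algebra.  The complete positivity of [L^alpha |-> D^alpha] obtained in this way
    is the noncommutative von Neumann inequality. *)
Lemma row_isometric_cp_map : exists pi : bop F F -> bop J J,
  cp_on (add_adj (free_disk_algebra F)) pi /\
  forall alpha, pi (word_op L alpha) = word_op S alpha.
Proof.
pose r n : C := 1 - n.+2%:R^-1.
have r0 n : 0 <= r n by rewrite subr_ge0 invf_le1// ler1n.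
have r1 n : r n < 1 by rewrite gtrBl invr_gt0.
have /choice[N0 N0P] n : exists N, forall k, (N <= k)%N -> r n ^+ k < n.+1%:R^-1.
  by apply: expr_lt_eps => //; rewrite invr_gt0.
(* The truncation is long enough for [r n ^+ N < n.+1%:R^-1], and at least [n],
   so that every word is eventually shorter. *)
pose psi n := poisson (r n) (maxn (N0 n) n).
have psi_cp n : cp_on setT (psi n) := poisson_cp (r n) _.
have psi_norm n T : `|psi n T| <= `|T| by apply: poisson_norm => //; exact: ltW.
have sysT : operator_system (setT : set (bop F F)) by split=> //; exact: closedT.
have psi_word alpha : (fun n => psi n (word_op L alpha)) @ \oo --> word_op S alpha.
  apply: cvg_distP => eps eps0; have m0 : 0 < (size alpha).+1%:R :> C by [].
  have [K KP] := natSinv_lt (divr_gt0 eps0 m0).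
  exists (maxn K (size alpha)) => n; rewrite geq_max => /andP[/KP Kn mn].
  rewrite ltr_pdivlMr// in Kn; apply: le_lt_trans Kn.
  rewrite (le_trans (poisson_word_dist _ _ _))//; [exact: ltW|by rewrite leq_max mn orbT|].
  rewrite -[(size alpha).+1%:R]natr1 [leRHS]mulrDr mulr1 lerD//; last by rewrite ltW// N0P// leq_maxl.
  rewrite mulrC ler_wpM2r// /r opprB addrC subrK lef_pV2 ?posrE//.
  by rewrite ler_nat.
pose M := [set T | exists X : bop J J, (fun n => psi n T) @ \oo --> X].
have Mc : closed M.
  apply: closed_seq => u T /choice[X uX] uT.
  have [Y XY] : exists Y : bop J J, X @ \oo --> Y.
    apply: bop_complete; apply: (cauchy_le (c := 1) _ uT) => // i j; rewrite mul1r.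
    rewrite -subr_ge0.
    apply: (@cvg_ge0 _ (fun n => `|u i - u j| - `|psi n (u i) - psi n (u j)| : C^o)).
      have cij : (fun n => `|psi n (u i) - psi n (u j)| : C^o) @ \oo --> (`|X i - X j| : C^o).
        by apply: cvg_norm; exact: (cvgB (uX i) (uX j)).
      exact: (cvgB (cvg_cst (`|u i - u j| : C^o)) cij).
    by move=> n; rewrite subr_ge0 -(cpB sysT (psi_cp n)).
  exists Y; apply: cvg_distP => eps eps0.
  have e3 : 0 < eps / 3 by rewrite divr_gt0.
  have [K1 H1] := cvg_dist uT e3; have [K2 H2] := cvg_dist XY e3.
  pose k := maxn K1 K2; have [K3 H3] := cvg_dist (uX k) e3.
  exists K3 => n Kn.
  have -> : Y - psi n T = (Y - X k) + (X k - psi n (u k)) + (psi n (u k) - psi n T).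
    by rewrite !addrA !subrK.
  have -> : eps = eps / 3 + eps / 3 + eps / 3 by field.
  rewrite (le_lt_trans (ler_normD _ _))// ltrD//.
    by rewrite (le_lt_trans (ler_normD _ _))// ltrD ?H2 ?H3// leq_maxr.
  rewrite -(cpB sysT (psi_cp n))// (le_lt_trans (psi_norm _ _))// distrC.
  by rewrite H1// leq_maxl.
have Ml : lin_subspace M.
  split=> [|a T1 T2 [X1 c1] [X2 c2]].
    by exists 0; under eq_fun do rewrite (cp0 sysT (psi_cp _)); exact: cvg_cst.
  exists (a *: X1 + X2); under eq_fun do rewrite (psi_cp _).1//.
  exact: cvgD (cvgZl_tmp (k := a) c1) c2.
have AM : add_adj (free_disk_algebra F) `<=` M.
  apply: add_adj_min => //.
    move=> T [X cX]; exists (adj X).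
    by under eq_fun do rewrite (cp_adj sysT (psi_cp _))//; exact: cvg_adj.
  rewrite free_disk_algebra_words; apply: closed_span_min => // _ [alpha _ <-].
  by exists (word_op S alpha).
pose pi T : bop J J := xget 0 [set X : bop J J | (fun n => psi n T) @ \oo --> X].
have piP T : M T -> (fun n => psi n T) @ \oo --> pi T.
  by move=> MT; exact: (@xgetPex _ 0 [set X : bop J J | (fun n => psi n T) @ \oo --> X] MT).
exists pi; split=> [|alpha]; last first.
  by apply: (cvgV_unique (piP _ _) (psi_word alpha)); exists (word_op S alpha).
split=> [a T1 T2 /AM M1 /AM M2|n A /= Ain Apsd x].
  apply: (cvgV_unique (piP _ (Ml.2 a _ _ M1 M2))).
  under eq_fun do rewrite (psi_cp _).1//.
  exact: cvgD (cvgZl_tmp (k := a) (piP _ M1)) (piP _ M2).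
apply: (@cvg_ge0 _ (fun k => \sum_i \sum_j inner (psi k (A i j) (x j)) (x i) : C^o)).
  apply: cvg_sum_ord => i; apply: cvg_sum_ord => j.
  exact: cvg_inner (cvg_bop_app (x := x j) (piP _ (AM _ (Ain i j)))) (cvg_cst (x i)).
by move=> k; exact: ((psi_cp k).2 n A).
Qed.

End PoissonTransform.

(** * The correspondence *)

Section Correspondence.
Variables (R : realType) (d : nat) (H : hilbertType R) (F : full_fock R d).
Variable b : @unit_ball R d -> bop H H.
Variables (Lb : rkhs (herglotz_kernel b)) (V : bop (hsum d Lb) Lb).
Hypothesis V_def : is_herglotz_isometry V.
Variable mu : add_adj (szego_span F) -> bop H H.
Hypothesis mu_def : is_mu b mu.
Local Notation B := (@unit_ball R d).
Local Notation L := (creation F).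
Local Notation A := (add_adj (free_disk_algebra F)).
Local Notation res w := (opinv (bid F - Lstar F (val w))).
Local Notation K0 := (kfun Lb (Defs.ball0 R d)).

Lemma ext_equiv_class (D1 D2 : isometric_extension V) :
  ext_equiv D1 D2 -> ext_equiv D1 = ext_equiv D2.
Proof.
move=> /(ext_equiv_moment V_def) D12; apply/funext => D; apply/propext.
rewrite !(ext_equiv_moment V_def).
by split=> eqD alpha h g; [rewrite -D12|rewrite D12].
Qed.

(** For [z = 0] the first factor in the defining relation of [mu] is [I]. *)
Lemma mu_resolvent (w : B) :
  total_ext mu (res w) = herglotz_kernel b (Defs.ball0 R d) w.
Proof.
have muS : add_adj (szego_span F) (res w).
  by apply: add_adj_sub; [exact: closed_span_lin|exact: szego_span_resolvent].
rewrite (total_extP mu muS); apply: mu_def.2 => /=.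
have -> : starL F (0 : 'rV_d) = 0.
  by rewrite /starL big1// => j _; rewrite mxE scale0r.
have -> : opinv (bid F - 0) = bid F.
  by rewrite subr0; apply: opinv_uniq; apply: bopE.
exact: bopE.
Qed.

Lemma cp_extension_cp (p : cp_extension mu) : cp_on A (total_ext (sval p)).
Proof.
by apply: total_ext_cp (svalP p).1; apply: add_adj_lin; exact: free_disk_lin.
Qed.

Lemma cp_extension_resolvent (p : cp_extension mu) (w : B) :
  total_ext (sval p) (res w) = herglotz_kernel b (Defs.ball0 R d) w.
Proof.
have muS : add_adj (szego_span F) (res w).
  by apply: add_adj_sub; [exact: closed_span_lin|exact: szego_span_resolvent].
have AS : A (res w).
  by apply: add_adj_sub; [exact: free_disk_lin|exact: free_disk_resolvent].
rewrite -mu_resolvent (total_extP _ AS) (total_extP _ muS).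
exact: (svalP p).2.
Qed.

(** The words generate the free disk algebra as a closed subspace. *)
Lemma cp_extension_inj (p q : cp_extension mu) :
  (forall alpha, total_ext (sval p) (word_op L alpha) = total_ext (sval q) (word_op L alpha)) ->
  p = q.
Proof.
move=> pq; have eqA := cp_on_eq (X := range (word_op L)) (free_disk_system F)
  (free_disk_system F) (cp_extension_cp p) (cp_extension_cp q).
suff : sval p = sval q by case: p q {pq eqA} => p pP [q qP] /= pq; exact: eq_exist.
apply/funext => x.
suff : total_ext (sval p) (val x) = total_ext (sval q) (val x) by rewrite !total_extE.
have gens T : range (word_op L) T ->
    [/\ A T, A T & total_ext (sval p) T = total_ext (sval q) T].
  move=> [alpha _ <-].
  by split=> //; apply: add_adj_sub; (exact: free_disk_lin || exact: free_disk_word).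
have [|_ _ //] := eqA gens (val x).
by rewrite -free_disk_algebra_words; exact: set_mem (valP x).
Qed.

(** Compressing the completely positive map [L^alpha |-> D^alpha] to [K_0 H] gives
    an extension of [mu_b] whose moments are those of [D]. *)
Lemma cp_extension_of (D : isometric_extension V) :
  exists p : cp_extension mu, forall alpha h g,
    inner (total_ext (sval p) (word_op L alpha) h) g = ext_moment D alpha h g.
Proof.
have [pi [pi_cp piL]] := row_isometric_cp_map F (ext_row_isometric (D := D)).
pose W := bcomp (ext_emb D) K0.
pose f T := bcomp (adj W) (bcomp (pi T) W).
have fE T h g : inner (f T h) g = inner (pi T (W h)) (W g).
  exact: (esym (adjPr W _ _)).
have fcp : cp_on A f.
  split=> [a S T AS AT|n X XA Xpsd x].
    apply: bopE => h; apply: inner_inj => g.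
    by rewrite fE pi_cp.1// !bopDE !bopZE !innerDl !innerZl !fE.
  have := pi_cp.2 _ _ XA Xpsd (fun i => W (x i)); congr (0 <= _).
  by apply: eq_bigr => i _; apply: eq_bigr => j _; rewrite fE.
have fD alpha h g : ext_moment D alpha h g = inner (f (word_op L alpha) h) g.
  by rewrite fE piL.
have mu_cp : cp_on (add_adj (szego_span F)) (total_ext mu).
  by apply: total_ext_cp mu_def.1; apply: add_adj_lin; exact: closed_span_lin.
have mu_f : forall T, add_adj (szego_span F) T -> total_ext mu T = f T.
  move=> T muT.
  have [|_ _ //] := cp_on_eq (szego_system F) (free_disk_system F) mu_cp fcp _ muT.
  move=> _ [z zB <-]; pose w : B := exist _ z (mem_set zB).
  split; last by rewrite (mu_resolvent w) (cp_of_extension_resolvent V_def w fcp fD).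
  - by apply: add_adj_sub; [exact: closed_span_lin|exact: (szego_span_resolvent w)].
  - by apply: add_adj_sub; [exact: free_disk_lin|exact: (free_disk_resolvent w)].
pose phi (x : A) := f (val x).
have phiP : completely_positive phi /\
    forall (x : add_adj (szego_span F)) (y : A), val x = val y -> phi y = mu x.
  split=> [|x y xy]; first exact: cp_restrict.
  by rewrite /phi -xy -(total_extE mu) mu_f//; exact: set_mem (valP x).
exists (exist _ phi phiP) => alpha h g /=.
have Aw : A (word_op L alpha).
  by apply: add_adj_sub; [exact: free_disk_lin|exact: free_disk_word].
by rewrite (total_extP phi Aw) fD.
Qed.

End Correspondence.

Theorem corollary3p16 (R : realType) (d : nat) (d_gt0 : (0 < d)%N)
    (H : hilbertType R) (H_separable : separable_space H)
    (F : full_fock R d)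
    (H2 : rkhs (@szego R d H))
    (b : @unit_ball R d -> bop H H)
    (b_ball : multiplier_ball H2 b)
    (b_pure : forall z, `|b z| < 1)
    (Lb : rkhs (herglotz_kernel b))
    (V : bop (hsum d Lb) Lb) (V_def : is_herglotz_isometry V)
    (mu : add_adj (szego_span F) -> bop H H) (mu_def : is_mu b mu) :
  exists Phi : cp_extension mu -> ext_class V, bijective Phi.
Proof.
have /choice[D DP] (p : cp_extension mu) : exists D : isometric_extension V,
    forall alpha h g, ext_moment D alpha h g =
      inner (total_ext (sval p) (word_op (creation F) alpha) h) g.
  apply: (extension_of_cp V_def d_gt0 H_separable (cp_extension_cp p)).
  exact: cp_extension_resolvent mu_def p.
pose Phi p : ext_class V := exist _ (ext_equiv (D p)) (ex_intro _ (D p) erefl).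
have Phi_inj p q : Phi p = Phi q -> p = q.
  move=> /(congr1 sval) /= pq; apply: cp_extension_inj => alpha.
  apply: bopE => h; apply: inner_inj => g; rewrite -!DP.
  suff /(ext_equiv_moment V_def) -> : ext_equiv (D p) (D q) by [].
  by rewrite pq; apply/(ext_equiv_moment V_def).
have /choice[G GP] c : exists p, Phi p = c.
  case: c => c [E cE].
  have [p pE] := cp_extension_of V_def mu_def E; exists p; apply: eq_exist.
  rewrite cE; apply: (ext_equiv_class V_def); apply/(ext_equiv_moment V_def) => alpha h g.
  by rewrite DP pE.
by exists Phi, G => [p|c]; [apply: Phi_inj; rewrite GP|exact: GP].
Qed.
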